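(* Let $d$ be the dimension, $\epsilon=1/(48d^2\sqrt d)$, and $\delta\in[0,1]$. Any deterministic algorithm (in the memory-constrained model below) that is guaranteed to solve the feasibility problem over the unit ball with accuracy $\epsilon$ either uses at least $d^{2-\delta}$ bits of memory, or makes at least $\tilde\Omega(d^{1+\delta})$ queries (on some instance).
   Context: $B_d(\mathbf x,r)=\{\mathbf x'\in\mathbb{R}^d:\|\mathbf x-\mathbf x'\|_2\le r\}$. In the feasibility problem there is an unknown convex set $Q\subset B_d(0,1)$, accessed via a separation oracle: for a query $\mathbf x\in\mathbb{R}^d$ it either returns $\mathsf{Success}$ (meaning $\mathbf x\in Q$) or returns a vector $\mathbf g\in\mathbb{R}^d$ with $\langle\mathbf g,\mathbf x-\mathbf x'\rangle>0$ for all $\mathbf x'\in Q$. An algorithm solves the feasibility problem with accuracy $\epsilon$ if it finds a point of $Q$ for every such instance for which there exists $\mathbf x^\star\in B_d(0,1)$ with $B_d(\mathbf x^\star,\epsilon)\subset Q$. An $M$-bit memory-constrained deterministic algorithm with access to an oracle $\mathcal O:\mathcal S\to\mathcal R$ is specified by a query function $\psi_{query}:\{0,1\}^M\to\mathcal S$ and an update function $\psi_{update}:\{0,1\}^M\times\mathcal S\times\mathcal R\to\{0,1\}^M$; it starts with memory $0^M$, at iteration $t$ queries $q_t=\psi_{query}(\mathsf{Memory}_{t-1})$, receives $r_t=\mathcal O(q_t)$ and sets $\mathsf{Memory}_t=\psi_{update}(\mathsf{Memory}_{t-1},q_t,r_t)$ (internal computations are unrestricted in memory); its last query is its output. $\tilde\Omega(\cdot)$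 hides universal constants and polylogarithmic factors in $d$ (asymptotic in $d$). *)

(* Defs.v *)
From HB Require Import structures.
From mathcomp Require Import all_boot all_order all_algebra.
From mathcomp Require Import all_classical all_reals all_analysis.
Set Implicit Arguments. Unset Strict Implicit. Unset Printing Implicit Defensive.
Import Order.TTheory GRing.Theory Num.Theory.
Local Open Scope ring_scope.
Local Open Scope classical_set_scope.

Section Feasibility.
Variables (R : realType) (d : nat).

Definition dot (x y : 'rV[R]_d) : R := \sum_(i < d) x 0 i * y 0 i.
Definition norm2 (x : 'rV[R]_d) : R := Num.sqrt (dot x x).

Definition ball2 (x : 'rV[R]_d) (r : R) : set 'rV[R]_d :=
  [set x' | norm2 (x - x') <= r].

Definition convex_set (Q : set 'rV[R]_d) : Prop :=
  forall x y t, Q x -> Q y -> 0 <= t -> t <= 1 -> Q (t *: x + (1 - t) *: y).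

(* oracle answers: None = Success, Some g = separating vector g *)
Definition response := option 'rV[R]_d.

Definition separation_oracle (Q : set 'rV[R]_d) (O : 'rV[R]_d -> response) : Prop :=
  forall x, (O x = None -> Q x) /\
            (forall g, O x = Some g -> forall x', Q x' -> 0 < dot g (x - x')).

Definition feasibility_instance (eps : R) (Q : set 'rV[R]_d)
  (O : 'rV[R]_d -> response) : Prop :=
  convex_set Q /\ Q `<=` ball2 0 1 /\ separation_oracle Q O /\
  exists xs, ball2 0 1 xs /\ ball2 xs eps `<=` Q.

Record mem_algo (M : nat) := MemAlgo {
  psi_query : M.-tuple bool -> 'rV[R]_d;
  psi_update : M.-tuple bool -> 'rV[R]_d -> response -> M.-tuple bool }.

Definition mem0 (M : nat) : M.-tuple bool := [tuple of nseq M false].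

Fixpoint memory (M : nat) (A : mem_algo M) (O : 'rV[R]_d -> response) (t : nat)
  : M.-tuple bool :=
  match t with
  | 0 => mem0 M
  | t'.+1 => let m := memory A O t' in
             let q := psi_query A m in psi_update A m q (O q)
  end.

(* the (t+1)-th query q_{t+1} = psi_query(Memory_t) *)
Definition query_at (M : nat) (A : mem_algo M) (O : 'rV[R]_d -> response) (t : nat)
  : 'rV[R]_d := psi_query A (memory A O t).

(* A solves feasibility with accuracy eps: on every instance some query
   is answered Success (that query, a point of Q, is its output). *)
Definition solves_feasibility (M : nat) (A : mem_algo M) (eps : R) : Prop :=
  forall Q O, feasibility_instance eps Q O ->
    exists t, O (query_at A O t) = None.

Definition makes_at_least (M : nat) (A : mem_algo M) (O : 'rV[R]_d -> response)
  (N : R) : Prop :=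
  forall t : nat, (t.+1)%:R < N -> O (query_at A O t) <> None.

End Feasibility.

(* Main.v *)
(* The adversary answers with the first violated constraint of a growing list:
   first [n = Theta(d)] slabs |<a_i, x>| <= eta, [a_i] having the entries of a
   grid row on [h] coordinates and one large entry on a private coordinate,
   then half-spaces <v_j, x> <= - tau.  Each time the algorithm would succeed at
   a point x_j, a new unit vector [v_j] is appended to the list; it lives in the
   block of O(k) coordinates of the current period (k consecutive [v]'s), has
   integer coordinates of size at most [d] up to normalization, is orthogonal to
   the earlier [v]'s and almost orthogonal to the x's of the period.  Such a
   vector exists by the pigeonhole principle, and restricting it to a block
   makes it cheap to describe: O(k log d) bits.

   If for every grid some period took at most n/2 queries, the grid could be
   compressed.  The memory at the start of the period, the list of the [v]'s and
   the revealed rows determine the points x_j of the period.  An unrevealed row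
   satisfies k triangular slab conditions at these points, so that it can be
   translated by any of q^k combinations of the v's of the period (q ~ sqrt d)
   and both the row and the combination can be recovered.  Hence
   q^(k n / 2) <= 2^M * (description of the v's) * 2^O(k n), which fails for
   [k ~ d^(1 - delta)] if M < d^(2 - delta).  There are Theta(d / k) periods of
   n/2 queries each, that is Theta(d^(1 + delta)) queries, without any
   logarithmic loss. *)
Require Import Defs.
From HB Require Import structures.
From mathcomp Require Import all_boot all_order all_algebra.
From mathcomp Require Import all_classical all_reals all_analysis.
From mathcomp Require Import ring lra zify.
Set Implicit Arguments. Unset Strict Implicit. Unset Printing Implicit Defensive.
Import Order.TTheory GRing.Theory Num.Theory.
Local Open Scope ring_scope.

(** * Euclidean inner product: Cauchy-Schwarz and Bessel *)

Section DotProduct.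
Variables (R : realType) (d : nat).
Implicit Types (x y z : 'rV[R]_d) (a : R).

Lemma dotC x y : dot x y = dot y x.
Proof. by apply: eq_bigr => i _; rewrite mulrC. Qed.

Lemma dotDl x y z : dot (x + y) z = dot x z + dot y z.
Proof. by rewrite -big_split; apply: eq_bigr => i _; rewrite mxE mulrDl. Qed.

Lemma dotZl a x y : dot (a *: x) y = a * dot x y.
Proof. by rewrite mulr_sumr; apply: eq_bigr => i _; rewrite mxE mulrA. Qed.

Lemma dotDr x y z : dot z (x + y) = dot z x + dot z y.
Proof. by rewrite dotC dotDl !(dotC z). Qed.

Lemma dotZr a x y : dot y (a *: x) = a * dot y x.
Proof. by rewrite dotC dotZl (dotC y). Qed.

Lemma dotNl x y : dot (- x) y = - dot x y.
Proof. by rewrite -scaleN1r dotZl mulN1r. Qed.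

Lemma dotNr x y : dot y (- x) = - dot y x.
Proof. by rewrite dotC dotNl (dotC y). Qed.

Lemma dotBr x y z : dot z (x - y) = dot z x - dot z y.
Proof. by rewrite dotDr dotNr. Qed.

Lemma dotBl x y z : dot (x - y) z = dot x z - dot y z.
Proof. by rewrite dotDl dotNl. Qed.

Lemma dot0l x : dot 0 x = 0.
Proof. by rewrite /dot big1 // => i _; rewrite mxE mul0r. Qed.

Lemma dot_suml (I : Type) (r : seq I) (P : pred I) (F : I -> 'rV[R]_d) y :
  dot (\sum_(i <- r | P i) F i) y = \sum_(i <- r | P i) dot (F i) y.
Proof.
rewrite (big_morph (fun u => dot u y) (id1 := 0) (op1 := +%R)) //; last exact: dot0l.
by move=> u v; rewrite dotDl.
Qed.

Lemma dot_sumr (I : Type) (r : seq I) (P : pred I) (F : I -> 'rV[R]_d) y :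
  dot y (\sum_(i <- r | P i) F i) = \sum_(i <- r | P i) dot y (F i).
Proof. by rewrite dotC dot_suml; apply: eq_bigr => i _; rewrite dotC. Qed.

Lemma dot_delta x (i : 'I_d) : dot (delta_mx 0 i) x = x 0 i.
Proof.
rewrite /dot (bigD1 i) //= big1 => [|j /negPf ji]; rewrite !mxE ?eqxx /=.
  by rewrite mul1r addr0.
by rewrite ji mul0r.
Qed.

Lemma dot_ge0 x : 0 <= dot x x.
Proof. by apply: sumr_ge0 => i _; rewrite -expr2 sqr_ge0. Qed.

Lemma sqr_coord_le_dot x i : x 0 i ^+ 2 <= dot x x.
Proof.
by rewrite /dot (bigD1 i) //= -expr2 lerDl sumr_ge0 // => j _; rewrite -expr2 sqr_ge0.
Qed.

Lemma cauchy_schwarz x y : dot x y ^+ 2 <= dot x x * dot y y.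
Proof.
have [x0|x0] := eqVneq (dot x x) 0.
  suff -> : dot x y = 0 by rewrite x0 expr2 !mul0r.
  apply: big1 => i _; have := sqr_coord_le_dot x i; rewrite x0 => xi.
  have /eqP : x 0 i ^+ 2 == 0 by rewrite eq_le xi sqr_ge0.
  by move/eqP; rewrite sqrf_eq0 => /eqP ->; rewrite mul0r.
have xp : 0 < dot x x by rewrite lt_def x0 dot_ge0.
have := dot_ge0 (dot x x *: y - dot x y *: x).
rewrite !(dotBl, dotBr, dotZl, dotZr) (dotC y x) => h.
have : 0 <= dot x x * (dot x x * dot y y - dot x y ^+ 2).
  by apply: (le_trans h); rewrite expr2; lra.
by rewrite pmulr_rge0 // subr_ge0.
Qed.

Lemma norm2_le a x : 0 <= a -> (norm2 x <= a) = (dot x x <= a ^+ 2).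
Proof.
move=> a0; rewrite /norm2 -(ler_sqr (sqrtr_ge0 _) a0).
by rewrite sqr_sqrtr // dot_ge0.
Qed.

Lemma dot_abs_le a b x y : 0 <= a -> 0 <= b ->
  dot x x <= a ^+ 2 -> dot y y <= b ^+ 2 -> `|dot x y| <= a * b.
Proof.
move=> a0 b0 hx hy.
rewrite -(ler_sqr (normr_ge0 _) (mulr_ge0 a0 b0)) real_normK ?num_real //.
by rewrite (le_trans (cauchy_schwarz x y)) // exprMn ler_pM ?dot_ge0.
Qed.

Lemma coord_abs_le1 x i : dot x x <= 1 -> `|x 0 i| <= 1.
Proof.
move=> hx; rewrite -(ler_sqr (normr_ge0 _) ler01) expr1n real_normK ?num_real //.
exact: le_trans (sqr_coord_le_dot x i) hx.
Qed.

(** Here [p] is the projection of the basis vector [e] to the span of the [v i], and [e - p] has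
    nonnegative square norm. *)
Lemma bessel_coord k (v : 'I_k -> 'rV[R]_d) (c : 'I_d) :
  (forall i j, dot (v i) (v j) = (i == j)%:R) -> \sum_i v i 0 c ^+ 2 <= 1.
Proof.
move=> ov; set e : 'rV[R]_d := delta_mx 0 c; set p := \sum_i v i 0 c *: v i.
have ep : dot e p = \sum_i v i 0 c ^+ 2.
  by rewrite dot_sumr; apply: eq_bigr => i _; rewrite dotZr dot_delta expr2.
have pp : dot p p = \sum_i v i 0 c ^+ 2.
  rewrite {1}/p dot_suml; apply: eq_bigr => i _; rewrite dotZl dot_sumr.
  rewrite (bigD1 i) //= dotZr ov eqxx mulr1 big1 ?addr0 // => j ji.
  by rewrite dotZr ov eq_sym (negPf ji) mulr0.
have ee : dot e e = 1 by rewrite dot_delta mxE !eqxx.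
have := dot_ge0 (e - p); rewrite !(dotBl, dotBr) (dotC p e) ep pp ee; lra.
Qed.

End DotProduct.

Lemma sqr_sum_le (R : realType) k (a : 'I_k -> R) :
  (\sum_i a i) ^+ 2 <= k%:R * \sum_i a i ^+ 2.
Proof.
pose x : 'rV[R]_k := \row_i a i; pose y : 'rV[R]_k := \row_i 1.
have -> : \sum_i a i = dot y x by apply: eq_bigr => i _; rewrite !mxE mul1r.
have -> : \sum_i a i ^+ 2 = dot x x by apply: eq_bigr => i _; rewrite !mxE expr2.
suff -> : k%:R = dot y y by exact: cauchy_schwarz.
by rewrite /dot (eq_bigr (fun=> 1)) ?sumr_const ?card_ord // => i _; rewrite !mxE mulr1.
Qed.

(** * Pigeonhole principle for small integer vectors *)

Section Siegel.
Variable R : realType.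

Lemma truncn_eq_dist (x y : R) : 0 <= x -> 0 <= y ->
  Num.truncn x = Num.truncn y -> `|x - y| < 1.
Proof.
move=> x0 y0 e; have := truncn_itv x0; have := truncn_itv y0; rewrite e.
by rewrite !mulrSr => /andP[? ?] /andP[? ?]; rewrite ltr_norml; apply/andP; split; lra.
Qed.

Lemma sum_int_bound D V (u : {ffun 'I_D -> 'I_V.+1}) (g : 'rV[R]_D) :
  (forall i, `|g 0 i| <= 1) ->
  `|\sum_i (u i)%:R * g 0 i| <= D%:R * V%:R.
Proof.
move=> hg; apply: (le_trans (ler_norm_sum _ _ _)).
apply: (@le_trans _ _ (\sum_(i < D) V%:R)); last first.
  by rewrite sumr_const card_ord mulr_natl.
apply: ler_sum => i _; rewrite normrM -[leRHS]mulr1 ler_pM //.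
by rewrite ger0_norm // ler_nat -ltnS ltn_ord.
Qed.

(** On the box each form takes values in an interval of length [2 * D * V], which is cut into [N]
    cells of width [rho]. There are more points than patterns of cells, so two points share all
    cells. *)
Lemma siegel D V N Q (rho : R) (gs : seq 'rV[R]_D) :
  (size gs <= Q)%N -> (forall g, g \in gs -> forall i, `|g 0 i| <= 1) ->
  (N ^ Q < V.+1 ^ D)%N -> 0 < rho -> 2 * D%:R * V%:R < N%:R * rho ->
  exists2 uu : {ffun 'I_D -> 'I_V.+1} * {ffun 'I_D -> 'I_V.+1}, uu.1 != uu.2 &
    forall g, g \in gs ->
      `|\sum_i ((uu.1 i)%:R - (uu.2 i)%:R) * g 0 i| < rho.
Proof.
move=> sQ hg hN rho0; case: N hN => [|N] hN hr.
  exfalso; move: hr; rewrite mul0r => hr.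
  have : (0 : R) <= 2 * D%:R * V%:R by rewrite !mulr_ge0.
  by rewrite leNgt hr.
pose F (u : {ffun 'I_D -> 'I_V.+1}) (g : 'rV[R]_D) :=
  (\sum_i (u i)%:R * g 0 i + D%:R * V%:R) / rho.
have F0 u (g : 'rV[R]_D) : (forall i, `|g 0 i| <= 1) -> 0 <= F u g.
  move=> /(sum_int_bound u); rewrite ler_norml => /andP[h _].
  by rewrite divr_ge0 //; [lra | exact: ltW].
have FN u (g : 'rV[R]_D) : (forall i, `|g 0 i| <= 1) -> (Num.truncn (F u g) < N.+1)%N.
  move=> hgi; have /(_ _ (F0 u g hgi)) /andP[h1 _] := @truncn_itv R.
  rewrite -(ltr_nat R); apply: (le_lt_trans h1).
  move: (sum_int_bound u hgi); rewrite ler_norml => /andP[_ h].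
  by rewrite ltr_pdivrMr //; lra.
(* Positions beyond the size of [gs] read the zero form; keys are only compared at the index of a
   member. *)
pose key u := [ffun j : 'I_Q => inord (Num.truncn (F u (nth 0 gs j))) : 'I_N.+1].
have : ~~ injectiveb key.
  apply/negP => /injectiveP /leq_card; rewrite !card_ffun !card_ord.
  by rewrite leqNgt hN.
move=> /injectivePn[u [u' nu ek]]; exists (u, u') => //= g gin.
have gi := hg _ gin.
have jlt : (index g gs < Q)%N by apply: leq_trans sQ; rewrite index_mem.
move: ek => /ffunP /(_ (Ordinal jlt)); rewrite !ffunE /= nth_index //.
move=> /(congr1 (@nat_of_ord _)); rewrite !inordK ?FN // => /truncn_eq_dist.
move=> /(_ (F0 _ _ gi) (F0 _ _ gi)); rewrite /F -mulrBl normrM normfV.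
rewrite (gtr0_norm rho0) ltr_pdivrMr // mul1r => h.
apply: le_lt_trans h; rewrite le_eqVlt; apply/orP; left; apply/eqP; congr (`|_|).
rewrite opprD addrACA subrr addr0 -sumrB.
by apply: eq_bigr => i _; rewrite mulrBl.
Qed.

End Siegel.

(** * Recovering a grid row and its translation *)

Section ShiftDecoding.
Variables (R : realType) (h k q B : nat).
Variables (ws ys : 'I_k -> 'rV[R]_h) (eta tau rho theta : R).

Definition dir_shift (t : 'I_k -> 'I_q) : 'rV[R]_h :=
  \sum_j ((t j)%:R * theta) *: ws j.

(* The summand [1] keeps the argument of [truncn] nonnegative. *)
Definition grid_shift (t : 'I_k -> 'I_q) (c : 'I_h) : nat :=
  Num.truncn (B%:R * (1 + dir_shift t 0 c)).

(** Cauchy-Schwarz over the [k] summands costs a factor [k]; Bessel at coordinate [c] then handles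
    the sum of squares at no further cost. *)
Lemma shift_le1 (t : 'I_k -> 'I_q) c : 0 <= theta ->
  (forall i j, dot (ws i) (ws j) = (i == j)%:R) ->
  theta ^+ 2 * q%:R ^+ 2 * k%:R <= 1 -> `|dir_shift t 0 c| <= 1.
Proof.
move=> th0 ow hth.
rewrite -(ler_sqr (normr_ge0 _) ler01) expr1n real_normK ?num_real //.
rewrite summxE; apply: (le_trans (sqr_sum_le _)); apply: le_trans hth.
rewrite mulrC ler_wpM2r ?ler0n //.
apply: (@le_trans _ _ (\sum_j (theta ^+ 2 * q%:R ^+ 2) * (ws j 0 c) ^+ 2)).
  apply: ler_sum => j _; rewrite mxE exprMn ler_wpM2r ?sqr_ge0 //.
  rewrite exprMn mulrC ler_wpM2l ?sqr_ge0 // lerXn2r ?nnegrE //.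
  by rewrite ler_nat ltnW.
rewrite -mulr_sumr -[leRHS]mulr1 ler_wpM2l ?mulr_ge0 ?sqr_ge0 //.
exact: bessel_coord.
Qed.

Lemma grid_shift_err (t : 'I_k -> 'I_q) c : `|dir_shift t 0 c| <= 1 ->
  B%:R * (1 + dir_shift t 0 c) - 1 < (grid_shift t c)%:R <= B%:R * (1 + dir_shift t 0 c).
Proof.
rewrite ler_norml => /andP[h1 _].
have : 0 <= B%:R * (1 + dir_shift t 0 c) by rewrite mulr_ge0 //; lra.
by move=> /truncn_itv /andP[-> /=]; rewrite -/(grid_shift _ _) mulrSr; lra.
Qed.

Lemma grid_shift_le (t : 'I_k -> 'I_q) c : `|dir_shift t 0 c| <= 1 ->
  (grid_shift t c <= 2 * B)%N.
Proof.
move=> h1; have /andP[_ h2] := grid_shift_err h1.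
rewrite -(ler_nat R) natrM mulrC; apply: (le_trans h2); rewrite ler_wpM2l //.
by move: h1; rewrite ler_norml => /andP[_]; lra.
Qed.

Hypotheses (B0 : (0 < B)%N) (th0 : 0 <= theta) (rho0 : 0 <= rho).
Hypothesis ys1 : forall i c, `|ys i 0 c| <= 1.
Hypothesis wsd : forall i, dot (ws i) (ys i) <= - tau.
Hypothesis wsu : forall i j : 'I_k, (i < j)%N -> `|dot (ws j) (ys i)| <= rho.
Hypothesis gap : 2 * eta + k%:R * (q%:R * theta * rho) + h%:R / B%:R < theta * tau.

Definition slab (b : 'I_k -> R) (s : 'I_h -> nat) :=
  forall i, `|\sum_c (s c)%:R / B%:R * ys i 0 c - b i| <= eta.

(* Triangular decoding: along [ys i] the directions [ws j], [j > i], are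
   negligible, so once [t j] is known for [j < i] the slab around [b i]
   leaves room for a single value of [t i]. *)
Lemma grid_shift_inj b (s s' : 'I_h -> nat) (t t' : 'I_k -> 'I_q) :
  (forall c, `|dir_shift t 0 c| <= 1) -> (forall c, `|dir_shift t' 0 c| <= 1) ->
  slab b s -> slab b s' ->
  (forall c, s c + grid_shift t c = s' c + grid_shift t' c)%N ->
  forall i, t i = t' i.
Proof.
move=> st st' hs hs' e.
have Bp : 0 < B%:R :> R by rewrite ltr0n.
(* Both rows lie in the same slab and their translates coincide, so the two translations differ
   little along [ys i]; rounding costs at most [1 / B] per coordinate. *)
have shd i : `|dot (dir_shift t - dir_shift t') (ys i)| <= 2 * eta + h%:R / B%:R.
  set S := \sum_c (s c)%:R / B%:R * ys i 0 c.
  set S' := \sum_c (s' c)%:R / B%:R * ys i 0 c.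
  have SS : `|S - S'| <= 2 * eta.
    move: (hs i) (hs' i); rewrite -/S -/S' !ler_norml => /andP[? ?] /andP[? ?].
    by apply/andP; split; lra.
  suff er : `|dot (dir_shift t - dir_shift t') (ys i) + (S - S')| <= h%:R / B%:R.
    move: SS er; rewrite !ler_norml => /andP[? ?] /andP[? ?].
    by apply/andP; split; lra.
  rewrite /S /S' -[X in _ + X]sumrB /dot -big_split /=.
  apply: (le_trans (ler_norm_sum _ _ _)).
  apply: (@le_trans _ _ (\sum_(c < h) B%:R^-1)); last first.
    by rewrite sumr_const card_ord mulr_natl.
  apply: ler_sum => c _; rewrite -mulrBl -mulrDl normrM -[leRHS]mulr1.
  rewrite ler_pM // !mxE.
  rewrite -(ler_pM2l Bp) mulfV ?gt_eqF // -{1}(gtr0_norm Bp) -normrM.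
  have /(congr1 (fun n => n%:R : R)) := e c; rewrite !natrD => ec.
  have /andP[? ?] := grid_shift_err (st c).
  have /andP[? ?] := grid_shift_err (st' c).
  rewrite -mulrBl mulrDr mulrCA mulfV ?gt_eqF // mulr1 ler_norml.
  by apply/andP; split; lra.
have tt' n : forall i : 'I_k, val i = n -> t i = t' i.
  elim/ltn_ind: n => n IH i ni.
  apply/eqP/negP => /negP ntt.
  have := shd i; rewrite /dir_shift -sumrB dot_suml (bigD1 i) //=.
  set T := dot _ _; set U := \sum_(_ < _ | _) _ => hTU.
  (* Terms with [j < i] vanish by induction; those with [j > i] are small by [wsu]. *)
  have UB : `|U| <= k%:R * (q%:R * theta * rho).
    apply: (le_trans (ler_norm_sum _ _ _)).
    apply: (@le_trans _ _ (\sum_(j < k) q%:R * theta * rho)); last first.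
      by rewrite sumr_const card_ord -[leLHS]mulr_natl.
    rewrite [leRHS](bigID (fun j => j != i)) /= -[leLHS]addr0.
    apply: lerD; last by apply: sumr_ge0 => j _; rewrite !mulr_ge0.
    apply: ler_sum => j ji; rewrite -scalerBl dotZl.
    have [jlt|jge] := ltnP j i.
      have -> : t j = t' j by apply: (IH j); rewrite -?ni.
      by rewrite subrr mul0r normr0 !mulr_ge0.
    have ilj : (i < j)%N by rewrite ltn_neqAle jge andbT eq_sym.
    rewrite normrM ler_pM ?wsu // -mulrBl normrM (ger0_norm th0) ler_wpM2r //.
    have := ltn_ord (t j); have := ltn_ord (t' j).
    rewrite -!(ltr_nat R) => ? ?.
    have := ler0n R (t j); have := ler0n R (t' j) => ? ?.
    by rewrite ler_norml; apply/andP; split; lra.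
  (* Distinct integers differ by at least 1, and [ws i] has product at most [- tau] with [ys i]; for
     negative [tau] the bound is trivial. *)
  have TB : theta * tau <= `|T|.
    rewrite /T -scalerBl dotZl normrM -mulrBl normrM (ger0_norm th0).
    have dist1 : 1 <= `|(t i)%:R - (t' i)%:R : R|.
      rewrite leNgt; apply/negP; rewrite ltr_norml => /andP[h1 h2].
      case/eqP: ntt; apply: val_inj; apply/eqP; rewrite eqn_leq /=.
      by rewrite -!(ltnS (nat_of_ord _)) -!(ltr_nat R) !mulrSr; apply/andP; split; lra.
    have [tau0|tau0] := leP 0 tau; last first.
      apply: (@le_trans _ _ 0); last by rewrite !mulr_ge0.
      by rewrite mulr_ge0_le0 // ltW.
    rewrite -mulrA -[leLHS]mul1r ler_pM ?mulr_ge0 // ler_wpM2l //.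
    rewrite ler_normr; apply/orP; right; rewrite lerNr; exact: wsd.
  have : `|T| <= `|T + U| + `|U| by rewrite -{1}(addrK U T) ler_normB.
  move=> hT; have : theta * tau <= 2 * eta + h%:R / B%:R + k%:R * (q%:R * theta * rho).
    exact: le_trans TB (le_trans hT (lerD hTU UB)).
  by move: gap; rewrite addrAC => /lt_le_trans h1 /h1; rewrite ltxx.
by move=> i; apply: tt' (erefl _).
Qed.

End ShiftDecoding.

(** The first index satisfying either predicate is the first hit of that predicate, hence satisfies
    the other too. This compares the answers for two grids that agree on the reported rows. *)
Lemma eq_ohead_filter (I : Type) (E : seq I) (a a' : pred I) :
  (forall i, ohead [seq i <- E | a i] = Some i -> a' i) ->
  (forall i, ohead [seq i <- E | a' i] = Some i -> a i) ->
  ohead [seq i <- E | a i] = ohead [seq i <- E | a' i].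
Proof.
elim: E => [//|i E IH] /=; case: ifP => [ai|nai] h1 h2.
  by rewrite (h1 i erefl).
by move: h2; case: ifP => [a'i /(_ i erefl)|_ h2]; [rewrite nai|exact: IH].
Qed.

(** * Separation oracles of finite lists of half-spaces *)

Section HalfspaceOracle.
Variables (R : realType) (d : nat).
Implicit Types (cs : seq ('rV[R]_d * R)) (c : 'rV[R]_d * R) (x : 'rV[R]_d).

Definition violated c x : bool := c.2 < dot c.1 x.

(** The unit ball is a constraint of its own, checked first; outside it the query itself is a
    separating vector. *)
Definition halfspace_oracle cs : 'rV[R]_d -> response R d := fun x =>
  if 1 < dot x x then Some x
  else omap fst (ohead [seq c <- cs | violated c x]).

Definition halfspace_body cs : set 'rV[R]_d :=
  [set x | dot x x <= 1 /\ forall c, c \in cs -> dot c.1 x <= c.2]%classic.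

Lemma halfspace_oracle_None cs x :
  halfspace_oracle cs x = None <-> halfspace_body cs x.
Proof.
rewrite /halfspace_oracle /halfspace_body /=; case: (ltP 1 (dot x x)) => hx.
  by split=> [//|[]].
split=> [|[_ hc]].
  case E: [seq c <- cs | violated c x] => [|c s] // _; split=> // c cin.
  rewrite leNgt; apply/negP => hv.
  have : c \in [seq c <- cs | violated c x] by rewrite mem_filter cin andbT.
  by rewrite E.
rewrite (@eq_in_filter _ _ pred0) ?filter_pred0 // => c /hc.
by rewrite /violated leNgt => /negPf.
Qed.

Lemma separation_halfspace_oracle cs :
  separation_oracle (halfspace_body cs) (halfspace_oracle cs).
Proof.
move=> x; split=> [/halfspace_oracle_None //|g].
rewrite /halfspace_oracle; case: (ltP 1 (dot x x)) => hx.
  case=> <- x' [hx' _]; rewrite dotBr subr_gt0.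
  have [h0|h0] := leP (dot x x') 0; first by apply: le_lt_trans h0 (lt_trans ltr01 hx).
  have x0 : 0 < dot x x := lt_trans ltr01 hx.
  rewrite -(ltr_sqr (ltW h0) (ltW x0)).
  apply: (le_lt_trans (cauchy_schwarz x x')); rewrite expr2 ltr_pM2l //.
  exact: le_lt_trans hx' hx.
case E: [seq c <- cs | violated c x] => [|c s] //= [<-] x' [_ hc].
have : c \in [seq c <- cs | violated c x] by rewrite E mem_head.
rewrite mem_filter => /andP[hv cin]; rewrite dotBr subr_gt0.
exact: le_lt_trans (hc _ cin) hv.
Qed.

Lemma convex_halfspace_body cs : Defs.convex_set (halfspace_body cs).
Proof.
move=> x y t [hx hcx] [hy hcy] t0 t1.
have t1' : 0 <= 1 - t by rewrite subr_ge0.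
split=> [|c cin]; last first.
  rewrite dotDr !dotZr.
  have -> : c.2 = t * c.2 + (1 - t) * c.2 by rewrite -mulrDl addrC subrK mul1r.
  by rewrite lerD // ler_wpM2l // ?hcx ?hcy.
rewrite dotDl !dotDr !dotZl !dotZr (dotC y x).
have hxy : dot x y <= 1.
  apply: le_trans (ler_norm _) _; rewrite -[leRHS]mul1r.
  by apply: dot_abs_le; rewrite ?expr1n.
have h1 : t * (t * dot x x) <= t * t * 1 by rewrite mulrA ler_wpM2l // mulr_ge0.
have h2 : t * ((1 - t) * dot x y) <= t * (1 - t) * 1.
  by rewrite mulrA ler_wpM2l // mulr_ge0.
have h3 : (1 - t) * ((1 - t) * dot y y) <= (1 - t) * (1 - t) * 1.
  by rewrite mulrA ler_wpM2l // mulr_ge0.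
move: (dot x x) (dot x y) (dot y y) h1 h2 h3 => a b c; lra.
Qed.

Lemma halfspace_instance cs (eps : R) xs : 0 <= eps ->
  (forall x, dot (xs - x) (xs - x) <= eps ^+ 2 -> halfspace_body cs x) ->
  feasibility_instance eps (halfspace_body cs) (halfspace_oracle cs).
Proof.
move=> eps0 hb; split; first exact: convex_halfspace_body.
have bs : (halfspace_body cs `<=` ball2 0 1)%classic.
  move=> x [hx _]; rewrite /ball2 /= norm2_le // sub0r dotNl dotNr opprK.
  by rewrite expr1n.
split=> //; split; first exact: separation_halfspace_oracle.
exists xs; split; first by apply/bs/hb; rewrite subrr dot0l sqr_ge0.
by move=> x; rewrite /ball2 /= norm2_le //; apply: hb.
Qed.

(** Only the first violated constraint is reported, so further constraints can change nothing but a
    success. This lets the adversary choose them late. *)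
Lemma halfspace_oracle_cat cs1 cs2 x : halfspace_oracle cs1 x <> None ->
  halfspace_oracle (cs1 ++ cs2) x = halfspace_oracle cs1 x.
Proof.
rewrite /halfspace_oracle; case: ifP => // _; rewrite filter_cat.
by case: [seq c <- cs1 | violated c x].
Qed.

Lemma eq_halfspace_oracle (I : Type) (E : seq I) (f f' : I -> 'rV[R]_d * R) ds x :
  ohead [seq i <- E | violated (f i) x] = ohead [seq i <- E | violated (f' i) x] ->
  (forall i, ohead [seq i <- E | violated (f i) x] = Some i -> f i = f' i) ->
  halfspace_oracle (map f E ++ ds) x = halfspace_oracle (map f' E ++ ds) x.
Proof.
rewrite /halfspace_oracle; case: ifP => // _.
rewrite !filter_cat !filter_map.
pose F := [seq i <- E | violated (f i) x]; pose F' := [seq i <- E | violated (f' i) x].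
change (ohead F = ohead F' -> (forall i, ohead F = Some i -> f i = f' i) ->
  omap fst (ohead (map f F ++ [seq c <- ds | violated c x])) =
  omap fst (ohead (map f' F' ++ [seq c <- ds | violated c x]))).
by case: F F' => [|i s] [|i' s'] //= [<-] /(_ i erefl) ->.
Qed.

End HalfspaceOracle.

(** * Runs of an algorithm against an oracle *)

Lemma eq_memory (R : realType) (d M : nat) (A : mem_algo R d M)
    (O O' : 'rV[R]_d -> response R d) T :
  (forall t, (t < T)%N -> O (query_at A O t) = O' (query_at A O t)) ->
  forall t, (t <= T)%N -> memory A O t = memory A O' t.
Proof.
move=> h; elim=> [//|t IH] tT /=; rewrite -IH; last exact: ltnW.
by rewrite -/(query_at A O t) h.
Qed.

Lemma first_success (R : realType) (d M : nat) (A : mem_algo R d M)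
    (O : 'rV[R]_d -> response R d) :
  (exists t, O (query_at A O t) = None) ->
  exists T, O (query_at A O T) = None /\
    forall t, (t < T)%N -> O (query_at A O t) <> None.
Proof.
move=> [t0 ht0].
have ex : exists t, `[< O (query_at A O t) = None >] by exists t0; apply/asboolP.
exists (ex_minn ex); case: ex_minnP => T /asboolP hT hmin; split=> // t tT ht.
by have := hmin t (asboolT ht); rewrite leqNgt tT.
Qed.

(** * The game: slabs of grid rows, then directions *)

Section Game.
Variables (R : realType) (h n B : nat) (W : finType) (w0 : W).
Variables (per : W -> nat) (vh : W -> 'rV[R]_h) (lam eta tau rho : R).

Definition grid := {ffun 'I_n -> {ffun 'I_h -> 'I_B}}.

Definition grid_row (s : {ffun 'I_h -> 'I_B}) : 'rV[R]_h :=
  \row_c ((s c)%:R / B%:R).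

(** The boolean selects a side of the slab. *)
Definition row_constraint (S : grid) (ib : 'I_n * bool) : 'rV[R]_(h + n) * R :=
  ((-1) ^+ ib.2 *: row_mx (grid_row (S ib.1)) (lam *: delta_mx 0 ib.1), eta).

Definition dir_constraint (w : W) : 'rV[R]_(h + n) * R := (row_mx (vh w) 0, - tau).

(** Rows precede directions, so that a longer [L] extends the list at its end only. *)
Definition constraints S (L : seq W) :=
  map (row_constraint S) (enum {: 'I_n * bool}) ++ map dir_constraint L.

Definition game_oracle S L := halfspace_oracle (constraints S L).

Lemma dot_row_mxl (a : 'rV[R]_h) (b : 'rV[R]_n) (x : 'rV[R]_(h + n)) :
  dot (row_mx a b) x = dot a (lsubmx x) + dot b (rsubmx x).
Proof.
rewrite /dot big_split_ord /=; congr (_ + _); apply: eq_bigr => i _.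
  by rewrite row_mxEl mxE.
by rewrite row_mxEr mxE.
Qed.

Lemma dot_lsubmx_le (x : 'rV[R]_(h + n)) : dot (lsubmx x) (lsubmx x) <= dot x x.
Proof.
rewrite -{3}(hsubmxK x) dot_row_mxl lerDl; exact: dot_ge0.
Qed.

Lemma game_body S L x : halfspace_body (constraints S L) x <->
  [/\ dot x x <= 1,
      forall i, `|dot (grid_row (S i)) (lsubmx x) + lam * rsubmx x 0 i| <= eta &
      forall w, w \in L -> dot (vh w) (lsubmx x) <= - tau].
Proof.
have rowE i b : dot (row_constraint S (i, b)).1 x =
    (-1) ^+ b * (dot (grid_row (S i)) (lsubmx x) + lam * rsubmx x 0 i).
  by rewrite /= dotZl dot_row_mxl dotZl dot_delta.
have dirE w : dot (dir_constraint w).1 x = dot (vh w) (lsubmx x).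
  by rewrite /= dot_row_mxl dot0l addr0.
split=> [[h1 hc]|[h1 hr hd]]; split=> //.
- move=> i; have hib b : dot (row_constraint S (i, b)).1 x <= eta.
    apply: (hc (row_constraint S (i, b))); rewrite mem_cat map_f //.
    by rewrite mem_enum.
  rewrite ler_norml; apply/andP; split.
    by have := hib true; rewrite rowE expr1 mulN1r lerNl.
  by have := hib false; rewrite rowE expr0 mul1r.
- move=> w wL; rewrite -dirE; apply: (hc (dir_constraint w)).
  by rewrite mem_cat (map_f dir_constraint) ?orbT.
- move=> c; rewrite mem_cat => /orP[/mapP[[i b] _ ->]|/mapP[w wL ->]].
    rewrite rowE; apply: le_trans (hr i); apply: le_trans (ler_norm _) _.
    by rewrite normrM normrX normrN1 expr1n mul1r.
  by rewrite dirE; exact: hd.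
Qed.

Lemma game_body_sub S L1 L2 x : {subset L1 <= L2} ->
  halfspace_body (constraints S L2) x -> halfspace_body (constraints S L1) x.
Proof.
move=> sub /game_body[h1 hr hd]; apply/game_body; split=> // w /sub; exact: hd.
Qed.

Definition orthonormal_dirs (L : seq W) := forall i j,
  (i < size L)%N -> (j < size L)%N ->
  dot (vh (nth w0 L i)) (vh (nth w0 L j)) = (i == j)%:R.

Section Feasibility.
Variables mu eps : R.
Hypotheses (B0 : (0 < B)%N) (lam0 : 0 < lam) (hlam : n%:R * h%:R <= lam ^+ 2).
Hypotheses (mu0 : 0 <= mu) (hmu : h%:R + lam ^+ 2 <= mu ^+ 2) (heta : mu * eps <= eta).
Hypotheses (eps0 : 0 <= eps) (hepst : eps <= tau) (heps1 : 12 * eps ^+ 2 <= 1).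

Lemma grid_row_dot (s : {ffun 'I_h -> 'I_B}) : dot (grid_row s) (grid_row s) <= h%:R.
Proof.
have -> : h%:R = \sum_(c < h) (1 : R) by rewrite sumr_const card_ord.
apply: ler_sum => c _; rewrite !mxE.
have h1 : (s c)%:R / B%:R <= 1 :> R.
  by rewrite ler_pdivrMr ?ltr0n // mul1r ler_nat ltnW.
by rewrite -[leRHS]mulr1 ler_pM ?divr_ge0.
Qed.

(* The centre is [-2 tau] times the sum of the directions, completed on the
   last [n] coordinates so that all rows vanish on it. *)
Lemma game_instance S L : orthonormal_dirs L ->
  16 * tau ^+ 2 * (size L)%:R <= 1 ->
  feasibility_instance eps (halfspace_body (constraints S L)) (game_oracle S L).
Proof.
move=> oL hL.
have tau0 : 0 <= tau := le_trans eps0 hepst.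
pose v i := vh (nth w0 L i).
pose sv : 'rV[R]_h := \sum_(i < size L) v i.
have svv (j : 'I_(size L)) : dot (v j) sv = 1.
  rewrite dot_sumr (bigD1 j) //= oL // eqxx big1 ?addr0 // => i ij.
  by rewrite oL // val_eqE eq_sym (negPf ij).
have sv2 : dot sv sv = (size L)%:R.
  rewrite {1}/sv dot_suml (eq_bigr (fun=> 1)) => [|j _]; last exact: svv.
  by rewrite sumr_const card_ord.
(* The factor 2 leaves a margin [tau >= eps] beyond the threshold [- tau]. *)
pose y := (- 2 * tau) *: sv.
have yy : dot y y <= 4^-1.
  by rewrite dotZl dotZr sv2 !mulrA; lra.
pose z : 'rV[R]_n := \row_i (- dot (grid_row (S i)) y / lam).
(* Each coordinate has square at most [h / (4 * lam ^+ 2)], and there are [n] of them. *)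
have zz : dot z z <= 4^-1.
  have lp : 0 < lam ^+ 2 by rewrite exprn_gt0.
  rewrite -(ler_pM2l lp) mulr_sumr.
  apply: (@le_trans _ _ (\sum_(i < n) h%:R * 4^-1)); last first.
    by rewrite sumr_const card_ord -[leLHS]mulr_natl mulrA ler_wpM2r // invr_ge0.
  apply: ler_sum => i _; rewrite !mxE -expr2 -exprMn mulrC mulfVK ?gt_eqF //.
  rewrite sqrrN; apply: (le_trans (cauchy_schwarz _ _)).
  by apply: ler_pM; rewrite ?dot_ge0 ?grid_row_dot.
have xx : dot (row_mx y z) (row_mx y z) <= 2^-1.
  by rewrite dot_row_mxl row_mxKl row_mxKr; lra.
apply: (@halfspace_instance _ _ _ _ (row_mx y z)) => // x hx.
have [e he xE] : exists2 e, dot e e <= eps ^+ 2 & x = row_mx y z - e.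
  by exists (row_mx y z - x); rewrite // opprB addrC subrK.
have el : dot (lsubmx e) (lsubmx e) <= eps ^+ 2 := le_trans (dot_lsubmx_le e) he.
apply/game_body; split.
(* Expanding this square controls the cross term: the square norm of [x] is at most 3/2 times that
   of the centre plus 3 times that of [e], hence at most [3 / 4 + 3 * eps ^+ 2 <= 1]. *)
- have := dot_ge0 (row_mx y z + 2 *: e).
  rewrite xE !(dotDl, dotDr, dotNl, dotNr, dotZl, dotZr) (dotC e (row_mx y z)).
  move: (dot (row_mx y z) (row_mx y z)) (dot (row_mx y z) e) (dot e e) xx he.
  by move=> a b c h1 h2 h3; have := heps1; lra.
(* The row vanishes at the centre, so only its product with [e] is left; [mu] bounds the norm of a
   full row. *)
- move=> i; rewrite xE -dot_delta -dotZl -dot_row_mxl dotBr.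
  rewrite dot_row_mxl row_mxKl row_mxKr dotZl dot_delta [z 0 i]mxE.
  rewrite mulrC mulfVK ?gt_eqF // addrN sub0r normrN.
  apply: le_trans heta; apply: dot_abs_le => //.
  rewrite dot_row_mxl row_mxKl row_mxKr !(dotZl, dotZr) dot_delta mxE !eqxx mulr1.
  by apply: le_trans hmu; rewrite lerD ?grid_row_dot.
- move=> w wL; have iL : (index w L < size L)%N by rewrite index_mem.
  have -> : vh w = v (Ordinal iL) by rewrite /v /= nth_index.
  have -> : lsubmx x = y - lsubmx e.
    by rewrite xE linearB /= row_mxKl.
  rewrite dotBr dotZr svv mulr1.
  have : `|dot (v (Ordinal iL)) (lsubmx e)| <= 1 * eps.
    by apply: dot_abs_le; rewrite // expr1n oL //= eqxx.
  by rewrite ler_norml => /andP[h1 h2]; have := hepst; lra.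
Qed.

End Feasibility.

(** * Runs against an adaptively growing list of directions *)

Section Run.
Variables (M : nat) (A : mem_algo R (h + n) M) (k P : nat).
Hypothesis k0 : (0 < k)%N.
Hypothesis solved : forall S L, orthonormal_dirs L -> (size L <= P * k)%N ->
  exists t, game_oracle S L (query_at A (game_oracle S L) t) = None.
Hypothesis dir_ex : forall p, (p < P)%N -> forall (ws : seq W) (xs : seq 'rV[R]_h),
  (size ws + size xs <= 2 * k)%N ->
  (forall x, x \in xs -> forall c, `|x 0 c| <= 1) ->
  exists w, [/\ per w = p, dot (vh w) (vh w) = 1,
    forall w', w' \in ws -> dot (vh w') (vh w) = 0 &
    forall x, x \in xs -> `|dot (vh w) x| <= rho].
Hypothesis dir_disj : forall w w', per w != per w' -> dot (vh w) (vh w') = 0.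
Hypothesis rho_tau : rho < tau.

Definition query S L t := query_at A (game_oracle S L) t.

(** The queries are always those of the run against the final list [L]. The last clause includes
    [j = i]: direction [i] is almost orthogonal even to the point that triggered its choice. *)
Definition run_spec S (L : seq W) (T : nat -> nat) := [/\
  orthonormal_dirs L,
  forall i, (i < size L)%N -> per (nth w0 L i) = (i %/ k)%N,
  forall r, (r <= size L)%N ->
    game_oracle S (take r L) (query S L (T r)) = None /\
    forall t, (t < T r)%N -> game_oracle S (take r L) (query S L t) <> None &
  forall i j, (i < size L)%N -> (i %/ k * k <= j <= i)%N ->
    `|dot (vh (nth w0 L i)) (lsubmx (query S L (T j)))| <= rho].

Lemma game_oracle_prefix S L1 L2 x : game_oracle S L1 x <> None ->
  game_oracle S (L1 ++ L2) x = game_oracle S L1 x.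
Proof.
rewrite /game_oracle /constraints map_cat catA; exact: halfspace_oracle_cat.
Qed.

(** Until the first success against [L1] both oracles give the same answers, hence the same
    memories. *)
Lemma query_prefix S L1 L2 T :
  (forall t, (t < T)%N -> game_oracle S L1 (query S L1 t) <> None) ->
  forall t, (t <= T)%N -> query S (L1 ++ L2) t = query S L1 t.
Proof.
move=> hT t tT; rewrite /query /query_at; congr psi_query; apply/esym.
by apply: (@eq_memory _ _ _ _ _ _ T) => // u uT; rewrite game_oracle_prefix //; exact: hT.
Qed.

(** Directions are appended one at a time. Orthogonality comes from [dir_ex] within a period and
    from [dir_disj] across periods; queries up to the latest success are unaffected. *)
Lemma run_exists S r : (r <= P * k)%N ->
  exists L T, size L = r /\ run_spec S L T.
Proof.
elim: r => [|r IH] rP.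
  have o0 : orthonormal_dirs [::] by [].
  have [T0 [hT0 hT0']] := first_success (solved S o0 (leq0n _)).
  exists [::], (fun=> T0); split=> //; split=> // -[|r].
have [L [T [sL [oL perL sucL nearL]]]] := IH (ltnW rP).
set r0 := (r %/ k * k)%N.
have r0r : (r0 <= r)%N by exact: leq_trunc_div.
pose X j : 'rV[R]_h := lsubmx (query S L (T j)).
(* The success points of the current period, the newest included. Together with at most [k - 1]
   earlier directions they respect the bound [2 * k] of [dir_ex]. *)
pose xs := [seq X j | j <- iota r0 (r - r0).+1].
have szs : (size (drop r0 L) + size xs <= 2 * k)%N.
  rewrite size_drop size_map size_iota sL.
  have -> : (r - r0 = r %% k)%N by rewrite {1}(divn_eq r k) addKn.
  by have := ltn_pmod r k0; lia.
have xs1 x : x \in xs -> forall c, `|x 0 c| <= 1.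
  move=> /mapP[j]; rewrite mem_iota => /andP[_ jr] -> c; apply: coord_abs_le1.
  have jr' : (j <= size L)%N by rewrite sL; lia.
  have [/halfspace_oracle_None /game_body[h1 _ _] _] := sucL j jr'.
  exact: le_trans (dot_lsubmx_le _) h1.
have rk : (r %/ k < P)%N by rewrite ltn_divLR.
have [w [perw ww wws wxs]] := dir_ex rk szs xs1.
have wL i : (i < r)%N -> dot (vh (nth w0 L i)) (vh w) = 0.
  move=> ir; have [ik|ik] := eqVneq (i %/ k)%N (r %/ k)%N; last first.
    by apply: dir_disj; rewrite perw perL ?sL.
  have r0i : (r0 <= i)%N by rewrite /r0 -ik leq_trunc_div.
  apply: wws; rewrite -(subnKC r0i) -nth_drop mem_nth // size_drop sL.
  by rewrite ltn_sub2r // (leq_ltn_trans r0i).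
pose L' := rcons L w.
have nthL' i : (i < r)%N -> nth w0 L' i = nth w0 L i.
  by move=> ir; rewrite nth_rcons sL ir.
have nthL'r : nth w0 L' r = w by rewrite nth_rcons sL ltnn eqxx.
have sL' : size L' = r.+1 by rewrite size_rcons sL.
have oL' : orthonormal_dirs L'.
  move=> i j; rewrite sL' !ltnS (leq_eqVlt i) (leq_eqVlt j).
  move=> /orP[/eqP->|ir] /orP[/eqP->|jr]; rewrite ?nthL'r ?nthL' ?eqxx //.
  - by rewrite dotC wL // gtn_eqF.
  - by rewrite wL // ltn_eqF.
  - by rewrite oL ?sL.
have [T1 [hT1 hT1']] : exists T1, game_oracle S L' (query S L' T1) = None /\
    forall t, (t < T1)%N -> game_oracle S L' (query S L' t) <> None.
  by apply: first_success; apply: solved; rewrite ?sL'.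
have qE j t : (j <= r)%N -> (t <= T j)%N -> query S L' t = query S L t.
  move=> jr tj; rewrite /L' -cats1.
  have qj L2 : query S (take j L ++ L2) t = query S (take j L) t.
    apply: query_prefix tj => u uj.
    have [_ hs] := sucL j (leq_trans jr (eq_leq (esym sL))).
    (* [sucL] concerns the run against [L], while [query_prefix] asks about the run against
       [take j L]; the two are identified by induction on time. *)
    elim/ltn_ind: u uj => u IHu uj.
    rewrite -(query_prefix (drop j L) (T := u)) ?cat_take_drop //; first exact: hs.
    by move=> t' t'u; apply: IHu => //; exact: ltn_trans uj.
  rewrite -{1}(cat_take_drop j L) -catA qj -(qj (drop j L)) cat_take_drop //.
have takeL' j : (j <= r)%N -> take j L' = take j L.
  move=> jr; rewrite /L' -cats1 take_cat sL; case: ltngtP jr => // -> _.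
  by rewrite subnn take0 cats0 -sL take_size.
exists L', (fun j => if j == r.+1 then T1 else T j); split=> //; split=> //.
- move=> i; rewrite sL' ltnS leq_eqVlt => /orP[/eqP->|ir].
    by rewrite nthL'r perw.
  by rewrite nthL' // perL ?sL.
- move=> j; rewrite sL' leq_eqVlt => /orP[/eqP->|].
    by rewrite eqxx -sL' take_size.
  rewrite ltnS => jr; rewrite ltn_eqF ?ltnS // takeL' //.
  have [h1 h2] := sucL j (leq_trans jr (eq_leq (esym sL))).
  split=> [|t tj]; first by rewrite (qE j).
  by rewrite (qE j) ?(ltnW tj) //; exact: h2.
- move=> i j; rewrite sL' ltnS => ir /andP[ij ji].
  have jr := leq_trans ji ir.
  rewrite ltn_eqF ?ltnS // (qE j) //.
  move: ir; rewrite leq_eqVlt => /orP[/eqP ir|ir]; last first.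
    by rewrite nthL' //; apply: nearL; rewrite ?sL ?ij.
  subst i; rewrite nthL'r; apply: wxs; apply: (map_f X); rewrite mem_iota ij /=.
  by rewrite -/r0 in ij *; lia.
Qed.

(** A success for [r + 1] directions is one for [r] directions. The times differ because direction
    [r] is almost orthogonal to the query at [T r], while the new constraint asks for a product at
    most [- tau]. *)
Lemma run_step S L T r : run_spec S L T -> (r < size L)%N -> (T r < T r.+1)%N.
Proof.
move=> [_ _ suc near] rL; rewrite ltnNge; apply/negP => le.
have [/halfspace_oracle_None hb _] := suc r.+1 rL.
have [_ hr'] := suc r (ltnW rL).
have hb' : halfspace_body (constraints S (take r L)) (query S L (T r.+1)).
  by apply: game_body_sub hb => w; rewrite (take_nth w0) // mem_rcons in_cons orbC => ->.
have eT : T r.+1 = T r.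
  apply/eqP; rewrite eqn_leq le leqNgt; apply/negP => /hr'; apply.
  exact/halfspace_oracle_None.
have /game_body[_ _ /(_ (nth w0 L r))] := hb.
rewrite (take_nth w0) // mem_rcons mem_head => /(_ isT).
have := near r r rL; rewrite leq_trunc_div leqnn => /(_ isT).
by rewrite eT ler_norml => /andP[h1 _] h2; have := rho_tau; lra.
Qed.

Lemma run_mono S L T r s : run_spec S L T -> (r <= s <= size L)%N -> (T r <= T s)%N.
Proof.
move=> hs /andP[]; elim: s => [|s IH]; first by rewrite leqn0 => /eqP ->.
rewrite leq_eqVlt => /orP[/eqP -> //|rs sL].
by apply: leq_trans (IH rs (ltnW sL)) (ltnW (run_step hs sL)).
Qed.

Definition hit S x : option ('I_n * bool) :=
  ohead [seq ib <- enum {: 'I_n * bool} | violated (row_constraint S ib) x].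

(** An answer depends on the grid only through the first violated row, so rows outside [Rv] are
    immaterial as long as neither grid reports one. *)
Lemma game_oracle_hit (S S' : grid) L (Rv : {set 'I_n}) x :
  {in Rv, S =1 S'} ->
  (forall ib, hit S x = Some ib -> ib.1 \in Rv) ->
  (forall ib, hit S' x = Some ib -> ib.1 \in Rv) ->
  game_oracle S L x = game_oracle S' L x.
Proof.
move=> eS h1 h2.
have rc ib : ib.1 \in Rv -> row_constraint S ib = row_constraint S' ib.
  by move=> iR; rewrite /row_constraint eS.
have hv (U : grid) ib : hit U x = Some ib -> violated (row_constraint U ib) x.
  rewrite /hit; case E: [seq _ <- _ | _] => [//|jb s] [<-].
  have : jb \in [seq i <- enum {: 'I_n * bool} | violated (row_constraint U i) x].
    by rewrite E mem_head.
  by rewrite mem_filter => /andP[].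
apply: eq_halfspace_oracle => [|ib hib]; last by apply/rc/h1.
apply: eq_ohead_filter => ib hib.
  by rewrite -rc; [exact: hv|exact: h1].
by rewrite rc; [exact: hv|exact: h2].
Qed.

Lemma game_oracle_None_hit S L x : game_oracle S L x = None -> hit S x = None.
Proof.
rewrite /hit => /halfspace_oracle_None[_ hc].
rewrite (@eq_in_filter _ _ pred0) ?filter_pred0 // => ib _.
apply/negbTE; rewrite -leNgt; apply: hc.
by rewrite mem_cat (map_f (row_constraint S)) // mem_enum.
Qed.

Definition revealed S (L : seq W) (T : nat -> nat) p : {set 'I_n} :=
  [set i | [exists j : 'I_(T (p.+1 * k)%N - T (p * k)%N),
     omap fst (hit S (query S L (T (p * k)%N + j))) == Some i]].

Lemma card_revealed S L T p :
  (#|revealed S L T p| <= T (p.+1 * k) - T (p * k))%N.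
Proof.
set l := (_ - _)%N; have -> : l = #|'I_l| by rewrite card_ord.
have sinj : injective (@Some 'I_n) by move=> i j [].
rewrite -(card_imset _ sinj).
pose F (j : 'I_l) := omap fst (hit S (query S L (T (p * k)%N + j))).
apply: leq_trans (leq_imset_card F 'I_l); apply: subset_leq_card.
apply/fintype.subsetP => o /imsetP[i]; rewrite inE => /existsP[j /eqP hj] ->.
by apply/imsetP; exists j.
Qed.

Definition memo S L t := memory A (game_oracle S L) t.

(** * Two grids with the same view of a period *)

Section Lockstep.
Variables (S S' : grid) (L : seq W) (T T' : nat -> nat) (p : nat).
Hypotheses (sL : size L = (P * k)%N) (pP : (p < P)%N).
Hypotheses (hS : run_spec S L T) (hS' : run_spec S' L T').
Hypothesis eR : revealed S L T p = revealed S' L T' p.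
Hypothesis eS : {in revealed S L T p, S =1 S'}.
Hypothesis eM : memo S L (T (p * k)%N) = memo S' L (T' (p * k)%N).

Let window_end : (p.+1 * k <= size L)%N.
Proof. by rewrite sL leq_mul2r pP orbT. Qed.

(** At the right end of the window the query is a success and hits no row, so [j] may equal the
    length of the window. *)
Lemma hit_revealed (U : grid) (V : nat -> nat) j ib : run_spec U L V ->
  (j <= V (p.+1 * k) - V (p * k))%N ->
  hit U (query U L (V (p * k)%N + j)) = Some ib -> ib.1 \in revealed U L V p.
Proof.
move=> hU; rewrite leq_eqVlt => /orP[/eqP ->|jl] hib; last first.
  by rewrite inE; apply/existsP; exists (Ordinal jl); rewrite hib.
move: hib; rewrite subnKC; last first.
  by apply: (run_mono hU); rewrite window_end leq_mul2r leqnSn orbT.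
have [_ _ /(_ _ window_end)[/game_oracle_None_hit -> _] _] := hU.
by [].
Qed.

Lemma lockstep_oracle j L' :
  (j <= T (p.+1 * k) - T (p * k))%N -> (j <= T' (p.+1 * k) - T' (p * k))%N ->
  query S L (T (p * k)%N + j) = query S' L (T' (p * k)%N + j) ->
  game_oracle S L' (query S L (T (p * k)%N + j)) =
  game_oracle S' L' (query S L (T (p * k)%N + j)).
Proof.
move=> jT jT' eq; apply: game_oracle_hit eS _ _ => ib.
  exact: hit_revealed.
by rewrite eq eR; exact: hit_revealed.
Qed.

(** The memories stay equal: equal memories give equal queries, and every row hit is common to both
    grids, so the answers agree. *)
Lemma lockstep_query j :
  (j <= T (p.+1 * k) - T (p * k))%N -> (j <= T' (p.+1 * k) - T' (p * k))%N ->
  query S L (T (p * k)%N + j) = query S' L (T' (p * k)%N + j).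
Proof.
have qm (U : grid) t : query U L t = psi_query A (memo U L t) by [].
move=> jT jT'; rewrite !qm; congr psi_query.
elim: j jT jT' => [|j IH] jT jT'; first by rewrite !addn0.
have em := IH (ltnW jT) (ltnW jT').
have eq : query S L (T (p * k)%N + j) = query S' L (T' (p * k)%N + j).
  by rewrite !qm em.
have mS (U : grid) t : memo U L t.+1 =
    psi_update A (memo U L t) (query U L t) (game_oracle U L (query U L t)) by [].
by rewrite !addnS !mS lockstep_oracle // -?eq ?em // ltnW.
Qed.

(** Otherwise the run for [S'] would meet, strictly before [T' r], the query at which [S] succeeds,
    and would succeed there too. *)
Lemma lockstep_time r : (p * k <= r <= p.+1 * k)%N ->
  (T' r - T' (p * k) <= T r - T (p * k))%N.
Proof.
move=> /andP[pr rp]; rewrite leqNgt; apply/negP => lt.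
have rL : (r <= size L)%N := leq_trans rp window_end.
have m0 : (T (p * k) <= T r)%N by apply: (run_mono hS); rewrite pr.
have m1 : (T r <= T (p.+1 * k))%N by apply: (run_mono hS); rewrite rp.
have m0' : (T' (p * k) <= T' r)%N by apply: (run_mono hS'); rewrite pr.
have m1' : (T' r <= T' (p.+1 * k))%N by apply: (run_mono hS'); rewrite rp.
have jT : (T r - T (p * k) <= T (p.+1 * k) - T (p * k))%N by rewrite leq_sub2r.
have jT' : (T r - T (p * k) <= T' (p.+1 * k) - T' (p * k))%N.
  by apply: leq_trans (ltnW lt) _; rewrite leq_sub2r.
have eq := lockstep_query jT jT'.
have [_ _ /(_ r rL)[hN _] _] := hS.
have [_ _ /(_ r rL)[_ hN'] _] := hS'.
have lt' : (T' (p * k) + (T r - T (p * k)) < T' r)%N by rewrite -ltn_subRL.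
apply: (hN' _ lt'); rewrite -eq -lockstep_oracle // subnKC //.
Qed.

End Lockstep.

Lemma lockstep (S S' : grid) L T T' p : size L = (P * k)%N -> (p < P)%N ->
  run_spec S L T -> run_spec S' L T' ->
  revealed S L T p = revealed S' L T' p ->
  {in revealed S L T p, S =1 S'} ->
  memo S L (T (p * k)%N) = memo S' L (T' (p * k)%N) ->
  forall r, (p * k <= r <= p.+1 * k)%N -> query S L (T r) = query S' L (T' r).
Proof.
move=> sL pP hS hS' eR eS eM r hr.
have eS' : {in revealed S' L T' p, S' =1 S} by move=> i; rewrite -eR => /eS.
have le := lockstep_time sL pP hS hS' eR eS eM hr.
have le' := lockstep_time sL pP hS' hS (esym eR) eS' (esym eM) hr.
have et : (T r - T (p * k) = T' r - T' (p * k))%N by apply/eqP; rewrite eqn_leq le le'.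
case/andP: hr => pr rp.
have we : (p.+1 * k <= size L)%N by rewrite sL leq_mul2r pP orbT.
have rL := leq_trans rp we.
have m0 : (T (p * k) <= T r)%N by apply: (run_mono hS); rewrite pr.
have m1 : (T r <= T (p.+1 * k))%N by apply: (run_mono hS); rewrite rp.
have m0' : (T' (p * k) <= T' r)%N by apply: (run_mono hS'); rewrite pr.
have m1' : (T' r <= T' (p.+1 * k))%N by apply: (run_mono hS'); rewrite rp.
rewrite -(subnKC m0) -(subnKC m0') -et; apply: lockstep_query => //.
  by rewrite leq_sub2r.
by rewrite et leq_sub2r.
Qed.

(** * Compressing a grid that has a short period *)

Section Encoding.
Variables (D q s : nat) (blk : nat -> 'I_D -> 'I_h) (theta : R) (i0 : 'I_n).
Hypotheses (B0 : (0 < B)%N) (th0 : 0 <= theta) (rho0 : 0 <= rho).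
Hypothesis gap : 2 * eta + k%:R * (q%:R * theta * rho) + h%:R / B%:R < theta * tau.
Hypothesis shift_bound : theta ^+ 2 * q%:R ^+ 2 * k%:R <= 1.
Hypothesis blk_supp : forall w c, vh w 0 c != 0 -> exists i, c = blk (per w) i.

Definition period_dirs (L : seq W) p : 'I_k -> 'rV[R]_h :=
  fun j => vh (nth w0 L (p * k + j)).

(** Revealed rows are left alone, since replaying the period needs their exact entries. *)
Definition encoded_row (Rv : {set 'I_n}) (L : seq W) p (S : grid)
    (ts : {ffun 'I_n -> {ffun 'I_k -> 'I_q}}) i c : nat :=
  if i \in Rv then S i c : nat
  else (S i c + grid_shift B (period_dirs L p) theta (ts i) c)%N.

(** All directions of the period vanish at [c], and the summand 1 in [grid_shift] contributes
    exactly [B]. *)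
Lemma grid_shift_out (L : seq W) p (t : 'I_k -> 'I_q) c :
  (forall j : 'I_k, per (nth w0 L (p * k + j)) = p) ->
  (forall i, c != blk p i) -> grid_shift B (period_dirs L p) theta t c = B.
Proof.
move=> perL hc; rewrite /grid_shift /dir_shift summxE big1 ?addr0 ?mulr1 ?natrK //.
move=> j _; rewrite mxE; have [->|/blk_supp[i ci]] := eqVneq (period_dirs L p j 0 c) 0.
  by rewrite mulr0.
by have := hc i; rewrite {1}ci perL eqxx.
Qed.

Lemma inord3_inj a b : (a < 3)%N -> (b < 3)%N -> inord a = inord b :> 'I_3 -> a = b.
Proof. by move=> ha hb /(congr1 (@nat_of_ord _)); rewrite !inordK. Qed.

Lemma period_div p (j : 'I_k) : ((p * k + j) %/ k = p)%N.
Proof. by rewrite divnMDl // divn_small ?addn0. Qed.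

Section Injectivity.
Variables (S S' : grid) (L : seq W) (T T' : nat -> nat) (p : nat).
Variables (ts ts' : {ffun 'I_n -> {ffun 'I_k -> 'I_q}}).
Let Rv := revealed S L T p.
Hypotheses (sL : size L = (P * k)%N) (pP : (p < P)%N).
Hypotheses (hS : run_spec S L T) (hS' : run_spec S' L T').
Hypothesis short : (T (p.+1 * k) - T (p * k) <= s)%N.
Hypothesis eR : Rv = revealed S' L T' p.
Hypothesis eM : memo S L (T (p * k)%N) = memo S' L (T' (p * k)%N).
Hypothesis eres : forall i c,
  (encoded_row Rv L p S ts i c = encoded_row Rv L p S' ts' i c %[mod B])%N.
Hypothesis ecar : forall i l,
  inord (encoded_row Rv L p S ts i (blk p l) %/ B) =
  inord (encoded_row Rv L p S' ts' i (blk p l) %/ B) :> 'I_3.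
Hypothesis etR : forall j : 'I_s,
  ts (nth i0 (enum Rv) j) = ts' (nth i0 (enum Rv) j).

Let lt_size j : (j < k)%N -> (p * k + j < size L)%N.
Proof.
move=> jk; rewrite sL; apply: (@leq_trans (p.+1 * k)); last by rewrite leq_mul2r pP orbT.
by rewrite mulSn addnC ltn_add2r.
Qed.

Let ws := period_dirs L p.
(** The successor makes [x j] satisfy the constraint of direction [j] of the period, while the
    directions [l > j] are almost orthogonal to it. *)
Let x (j : 'I_k) := query S L (T (p * k + j).+1).

Let perL (j : 'I_k) : per (nth w0 L (p * k + j)) = p.
Proof. by have [_ perE _ _] := hS; rewrite perE ?lt_size // period_div. Qed.

Let ows i j : dot (ws i) (ws j) = (i == j)%:R.
Proof.
by have [oL _ _ _] := hS; rewrite oL ?lt_size // eqn_add2l val_eqE.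
Qed.

Let shift1 (t : 'I_k -> 'I_q) c : `|dir_shift ws theta t 0 c| <= 1.
Proof. exact: shift_le1. Qed.

Lemma encoded_revealed : {in Rv, S =1 S'}.
Proof.
move=> i iR; apply/ffunP => c; apply: val_inj => /=.
by have := eres i c; rewrite /encoded_row iR !modn_small.
Qed.

Let body_x (j : 'I_k) : halfspace_body (constraints S (take (p * k + j).+1 L)) (x j).
Proof.
have [_ _ suc _] := hS.
by have [/halfspace_oracle_None] := suc _ (lt_size (ltn_ord j)).
Qed.

Let body_x' (j : 'I_k) : halfspace_body (constraints S' (take (p * k + j).+1 L)) (x j).
Proof.
rewrite /x (lockstep sL pP hS hS' eR encoded_revealed eM); last first.
  by rewrite leqW ?leq_addr //= mulSn addnC ltn_add2r.
have [_ _ suc _] := hS'.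
by have [/halfspace_oracle_None] := suc _ (lt_size (ltn_ord j)).
Qed.

(** Encoded entries are below [3 * B], so residue and quotient determine them. Off the block the
    translation is the constant [B] and the residue suffices; quotients thus cost [3 ^ D] per
    row. *)
Lemma encoded_eq i c : i \notin Rv ->
  (S i c + grid_shift B ws theta (ts i) c =
   S' i c + grid_shift B ws theta (ts' i) c)%N.
Proof.
move=> iR; have := eres i c; have := ecar i.
rewrite /encoded_row (negPf iR) -/ws => ecari ec.
have lt3 (U : grid) (t : 'I_k -> 'I_q) : ((U i c + grid_shift B ws theta t c) %/ B < 3)%N.
  rewrite ltn_divLR // (_ : (3 * B = B + 2 * B)%N); last by lia.
  have := grid_shift_le B (shift1 t c); have := ltn_ord (U i c); lia.
have [/existsP[l /eqP cl]|/existsPn cn] := boolP [exists l, c == blk p l].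
  rewrite (divn_eq (S i c + _) B) (divn_eq (S' i c + _) B) ec; congr (_ * _ + _)%N.
  by apply: inord3_inj; rewrite ?lt3 // cl.
move: ec; rewrite !(grid_shift_out _ perL) // => /eqP.
by rewrite eqn_modDr !modn_small // => /eqP ->.
Qed.

(** For revealed rows, at most [s] in number, the combination is stored explicitly. For the others
    [lockstep] puts the points [x j] in the slabs of both grids, and the triangular decoding
    applies. *)
Lemma encoding_inj : S = S' /\ ts = ts'.
Proof.
have ets i : ts i = ts' i.
  have [iR|iR] := boolP (i \in Rv).
    have ix : (index i (enum Rv) < s)%N.
      rewrite (leq_trans _ short) // (leq_trans _ (card_revealed S L T p)) //.
      by rewrite cardE index_mem mem_enum.
    by have := etR (Ordinal ix); rewrite /= nth_index ?mem_enum.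
  apply/ffunP.
  (* The private coordinate of row [i] is read off [x j], so it gives the centre of the slab. *)
  pose b j : R := - (lam * rsubmx (x j) 0 i).
  have slabS (U : grid) (j : 'I_k) : halfspace_body (constraints U (take (p * k + j).+1 L)) (x j) ->
      `|\sum_c (U i c)%:R / B%:R * lsubmx (x j) 0 c - b j| <= eta.
    move=> /game_body[_ /(_ i) hi _]; apply: le_trans hi.
    rewrite le_eqVlt; apply/orP; left; apply/eqP; congr (`|_|).
    by rewrite opprK; congr (_ + _); apply: eq_bigr => c _; rewrite [in RHS]mxE.
  apply: (@grid_shift_inj R h k q B ws (fun j => lsubmx (x j)) eta tau rho theta
            B0 th0 rho0 _ _ _ gap b (fun c => S i c) (fun c => S' i c) (ts i) (ts' i)).
  - move=> j c; apply: coord_abs_le1.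
    by have /game_body[h1 _ _] := body_x j; exact: le_trans (dot_lsubmx_le _) h1.
  - move=> j; have /game_body[_ _] := body_x j; apply.
    by rewrite (take_nth w0) ?lt_size // mem_rcons mem_head.
  - move=> j l jl; have [_ _ _ near] := hS; apply: near; first exact: lt_size.
    by rewrite period_div leqW ?leq_addr //= ltn_add2l.
  - exact: shift1.
  - exact: shift1.
  - by move=> j; exact: slabS (body_x j).
  - by move=> j; exact: slabS (body_x' j).
  - by move=> c; exact: encoded_eq.
split; last by apply/ffunP.
apply/ffunP => i; have [iR|iR] := boolP (i \in Rv); first exact: encoded_revealed.
apply/ffunP => c; apply: val_inj => /=.
by have := encoded_eq c iR; rewrite ets => /addIn.
Qed.

End Injectivity.

Lemma encoding_card :
  (forall S : grid, exists p L T, [/\ size L = (P * k)%N, (p < P)%N, run_spec S L T &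
     (T (p.+1 * k) - T (p * k) <= s)%N]) ->
  ((q ^ k) ^ n <= P * 2 ^ M * #|W| ^ (P * k) * 2 ^ n * (3 ^ D) ^ n * (q ^ k) ^ s)%N.
Proof.
move=> hyp.
have /choice[f hf] : forall S : grid,
    exists g : 'I_P * (P * k).-tuple W * (nat -> nat),
    run_spec S g.1.2 g.2 /\ (g.2 (g.1.1.+1 * k) - g.2 (g.1.1 * k) <= s)%N.
  move=> S; have [p [L [T [sL pP hS sh]]]] := hyp S.
  by exists (Ordinal pP, tcast (erefl _) (Tuple (introT eqP sL)), T).
pose pS S := (f S).1.1; pose LS S := (f S).1.2; pose TS S := (f S).2.
pose RS S := revealed S (LS S) (TS S) (pS S).
pose eS (a : grid * {ffun 'I_n -> {ffun 'I_k -> 'I_q}}) :=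
  encoded_row (RS a.1) (LS a.1) (pS a.1) a.1 a.2.
(* In order: period, memory at its start, directions, revealed set, quotients on the block,
   combinations of the revealed rows (padded by that of [i0]), residues. *)
pose enc a : 'I_P * M.-tuple bool * (P * k).-tuple W * {set 'I_n} *
    {ffun 'I_n -> {ffun 'I_D -> 'I_3}} * {ffun 'I_s -> {ffun 'I_k -> 'I_q}} *
    {ffun 'I_n -> {ffun 'I_h -> 'I_B}} :=
  (pS a.1, memo a.1 (LS a.1) (TS a.1 (pS a.1 * k)%N), LS a.1, RS a.1,
   [ffun i => [ffun l => inord (eS a i (blk (pS a.1) l) %/ B)]],
   [ffun j : 'I_s => a.2 (nth i0 (enum (RS a.1)) j)],
   [ffun i => [ffun c => Ordinal (ltn_pmod (eS a i c) B0)]]).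
have enc_inj : injective enc.
  move=> [S ts] [S' ts'] [ep em eL eR ec et er].
  have [hS sh] := hf S; have [hS' _] := hf S'.
  rewrite -/(LS S) -/(TS S) -/(pS S) in hS sh.
  rewrite -/(LS S') -/(TS S') -/(pS S') in hS'.
  have eL' : LS S' = LS S by rewrite eL.
  have ep' : pS S' = pS S by rewrite ep.
  rewrite eL' in hS'.
  have eR' : RS S = revealed S' (LS S) (TS S') (pS S) by rewrite eR /RS eL' ep'.
  have [-> -> //] : S = S' /\ ts = ts'.
  apply: (encoding_inj (size_tuple _) (ltn_ord _) hS hS' sh eR').
  - by rewrite em eL' ep'.
  - move=> i c; move/ffunP: er => /(_ i); rewrite !ffunE => /ffunP /(_ c).
    rewrite !ffunE => /(congr1 (@nat_of_ord _)) /=.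
    by rewrite /eS /= -eR eL' ep'.
  - move=> i l; move/ffunP: ec => /(_ i); rewrite !ffunE => /ffunP /(_ l).
    by rewrite !ffunE /eS /= -eR eL' ep'.
  - by move=> j; move/ffunP: et => /(_ j); rewrite !ffunE -eR.
have card_setn : #|{: {set 'I_n}}| = (2 ^ n)%N.
  by rewrite -cardsT -powersetT card_powerset cardsT card_ord.
have := leq_card enc enc_inj.
rewrite !card_prod card_setn !card_ffun !card_tuple !card_ord card_bool.
(* There are as many residue tables as grids; this factor cancels. *)
by rewrite mulnC leq_pmul2r ?expn_gt0 ?B0.
Qed.

(** By counting, some grid has only periods of more than [s] queries; these add up over [P]
    periods. *)
Lemma long_run :
  (P * 2 ^ M * #|W| ^ (P * k) * 2 ^ n * (3 ^ D) ^ n * (q ^ k) ^ s < (q ^ k) ^ n)%N ->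
  exists (S : grid) L, [/\ orthonormal_dirs L, size L = (P * k)%N &
    forall t, (t < P * s)%N -> game_oracle S L (query S L t) <> None].
Proof.
move=> big; have /existsNP[S hS] : ~ (forall S : grid, exists p L T,
    [/\ size L = (P * k)%N, (p < P)%N, run_spec S L T &
     (T (p.+1 * k) - T (p * k) <= s)%N]).
  by move=> /encoding_card; rewrite leqNgt big.
have [L [T [sL hT]]] := run_exists S (leqnn (P * k)).
have Tp p : (p <= P)%N -> (p * s <= T (p * k))%N.
  elim: p => [//|p IH] pP; have := IH (ltnW pP).
  have /negP : ~ (T (p.+1 * k) - T (p * k) <= s)%N.
    by move=> sh; apply: hS; exists p, L, T.
  by rewrite mulSn; lia.
exists S, L; have [oL _ suc _] := hT; split=> // t tP.
have := suc _ (leqnn _); rewrite take_size sL => -[_]; apply.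
exact: leq_trans tP (Tp _ (leqnn P)).
Qed.

End Encoding.
End Run.

End Game.

(** * Integer directions supported on blocks *)

Section Directions.
Variables (R : realType) (h D V P : nat) (blk : nat -> 'I_D -> 'I_h).
Hypothesis blk_inj : forall p p' i i', (p < P)%N -> (p' < P)%N ->
  blk p i = blk p' i' -> p = p' /\ i = i'.

(** A finite type, so that lists of directions can be counted; integers from [- V] to [V] are stored
    with offset [V]. *)
Definition dir := ('I_P * {ffun 'I_D -> 'I_(2 * V).+1})%type.
Definition dir_period (w : dir) : nat := w.1.
Definition dir_int (w : dir) (i : 'I_D) : int := (w.2 i)%:Z - V%:Z.
Definition dir_sqnorm (w : dir) : R := \sum_i ((dir_int w i)%:~R) ^+ 2.
Definition raw_dir (w : dir) : 'rV[R]_h :=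
  \sum_i (dir_int w i)%:~R *: delta_mx 0 (blk w.1 i).
Definition unit_dir (w : dir) : 'rV[R]_h := (Num.sqrt (dir_sqnorm w))^-1 *: raw_dir w.

Lemma dot_raw_dir w x : dot (raw_dir w) x = \sum_i (dir_int w i)%:~R * x 0 (blk w.1 i).
Proof. by rewrite dot_suml; apply: eq_bigr => i _; rewrite dotZl dot_delta. Qed.

Lemma raw_dir_blk (w : dir) p i : (p < P)%N ->
  raw_dir w 0 (blk p i) = (p == w.1)%:R * (dir_int w i)%:~R.
Proof.
move=> pP; rewrite summxE; have [pw|pw] := eqVneq p (w.1 : nat); last first.
  rewrite mul0r big1 // => j _; rewrite !mxE eqxx /=.
  case: eqP => [/(blk_inj pP (ltn_ord _))[e _]|_]; last by rewrite mulr0.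
  by rewrite e eqxx in pw.
rewrite mul1r (bigD1 i) //= pw !mxE !eqxx mulr1 big1 ?addr0 // => j ji.
rewrite !mxE eqxx /=; case: eqP => [|_]; last by rewrite mulr0.
by move=> /(blk_inj (ltn_ord _) (ltn_ord _))[_ e]; rewrite e eqxx in ji.
Qed.

Lemma dot_raw_dirs w w' : dot (raw_dir w) (raw_dir w') =
  (w.1 == w'.1)%:R * (\sum_i dir_int w i * dir_int w' i)%:~R.
Proof.
rewrite dot_raw_dir rmorph_sum mulr_sumr; apply: eq_bigr => i _ /=.
by rewrite raw_dir_blk // val_eqE intrM; ring.
Qed.

Lemma unit_dir_disj w w' : dir_period w != dir_period w' ->
  dot (unit_dir w) (unit_dir w') = 0.
Proof.
by rewrite /dir_period val_eqE dotZl dotZr dot_raw_dirs => /negPf ->; rewrite mul0r !mulr0.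
Qed.

Lemma unit_dir_supp w c : unit_dir w 0 c != 0 -> exists i, c = blk (dir_period w) i.
Proof.
move=> nz; suff /existsP[i /eqP ci] : [exists i, c == blk (dir_period w) i] by exists i.
apply: contraNT nz; rewrite negb_exists => /forallP hc.
rewrite mxE summxE big1 ?mulr0 // => i _; rewrite !mxE eqxx /=.
by rewrite (negPf (hc i)) mulr0.
Qed.

Lemma card_dir : #|{: dir}| = (P * (2 * V).+1 ^ D)%N.
Proof. by rewrite card_prod card_ffun !card_ord. Qed.

(** [siegel] is applied to the earlier directions scaled by [1 / V] and to the points restricted to
    the block. With a direction the product is an integer of size below [rho * V <= 1], hence 0. For
    points normalization only helps, a nonzero integer vector having norm at least 1. *)
Lemma unit_dir_ex (rho : R) Q N : 0 < rho -> (0 < V)%N -> rho * V%:R <= 1 ->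
  (N ^ Q < V.+1 ^ D)%N -> 2 * D%:R * V%:R < N%:R * rho ->
  forall p, (p < P)%N -> forall (ws : seq dir) (xs : seq 'rV[R]_h),
  (size ws + size xs <= Q)%N ->
  (forall x, x \in xs -> forall c, `|x 0 c| <= 1) ->
  exists w, [/\ dir_period w = p, dot (unit_dir w) (unit_dir w) = 1,
    forall w', w' \in ws -> dot (unit_dir w') (unit_dir w) = 0 &
    forall x, x \in xs -> `|dot (unit_dir w) x| <= rho].
Proof.
move=> rho0 V0 rhoV hN hrho p pP ws xs sz xs1.
have Vp : 0 < V%:R :> R by rewrite ltr0n.
pose wrow (w : dir) : 'rV[R]_D := \row_i ((dir_int w i)%:~R / V%:R).
pose xrow (x : 'rV[R]_h) : 'rV[R]_D := \row_i x 0 (blk p i).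
have dint w i : `|(dir_int w i)%:~R| <= V%:R :> R.
  rewrite /dir_int rmorphB /= ler_norml.
  have := ltn_ord (w.2 i); rewrite ltnS -(ler_nat R) natrM => h1.
  have := ler0n R (w.2 i) => h2.
  by apply/andP; split; rewrite -!pmulrn; lra.
have gs1 g : g \in map wrow ws ++ map xrow xs -> forall i, `|g 0 i| <= 1.
  rewrite mem_cat => /orP[/mapP[w _ ->]|/mapP[x xin ->]] i; rewrite mxE.
    by rewrite normrM normfV (gtr0_norm Vp) ler_pdivrMr // mul1r.
  exact: xs1.
have szg : (size (map wrow ws ++ map xrow xs) <= Q)%N by rewrite size_cat !size_map.
have [[u u'] /= nu hu] := siegel szg gs1 hN rho0 hrho.
have uV (v : {ffun 'I_D -> 'I_V.+1}) i : (v i <= V)%N by rewrite -ltnS.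
(* The truncated subtraction is exact because [u' i <= V]. *)
pose w : dir := (Ordinal pP, [ffun i => inord (u i + V - u' i)]).
have wE i : dir_int w i = (u i)%:Z - (u' i)%:Z.
  rewrite /dir_int ffunE inordK.
    by have := uV u i; have := uV u' i; lia.
  by have := uV u i; have := uV u' i; lia.
have wR i : (dir_int w i)%:~R = (u i)%:R - (u' i)%:R :> R.
  by rewrite wE rmorphB.
have sq_ge1 : 1 <= dir_sqnorm w.
  have [i ui] : exists i, u i != u' i.
    apply/existsP; apply: contraNT nu; rewrite negb_exists => /forallP uu.
    by apply/eqP/ffunP => i; apply/eqP; have := uu i; rewrite negbK.
  rewrite /dir_sqnorm (bigD1 i) //= -[leLHS]addr0.
  apply: lerD; last by apply: sumr_ge0 => j _; rewrite sqr_ge0.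
  rewrite -rmorphXn /= -[leLHS]/(1%:~R) ler_int.
  have : dir_int w i != 0.
    by rewrite wE subr_eq0 eqz_nat val_eqE.
  by rewrite -sqrf_eq0 => nz; have := sqr_ge0 (dir_int w i); lia.
have sq0 : 0 < dir_sqnorm w := lt_le_trans ltr01 sq_ge1.
have raw_sq : dot (raw_dir w) (raw_dir w) = dir_sqnorm w.
  rewrite dot_raw_dirs eqxx mul1r rmorph_sum /=; apply: eq_bigr => i _.
  by rewrite intrM expr2.
exists w; split=> //.
- rewrite dotZl dotZr raw_sq mulrA -invfM -expr2 sqr_sqrtr ?ltW //.
  by rewrite mulVf // gt_eqF.
- move=> w' win; rewrite dotZl dotZr dot_raw_dirs.
  suff -> : \sum_i dir_int w' i * dir_int w i = 0 by rewrite !mulr0.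
  have := hu (wrow w'); rewrite mem_cat map_f // => /(_ isT).
  set Z := \sum_i _ * _.
  have -> : \sum_i ((u i)%:R - (u' i)%:R) * wrow w' 0 i = Z%:~R / V%:R :> R.
    rewrite /Z rmorph_sum mulr_suml; apply: eq_bigr => i _ /=.
    by rewrite mxE intrM wR; ring.
  rewrite normrM normfV (gtr0_norm Vp) ltr_pdivrMr // => hZ.
  have := lt_le_trans hZ rhoV; rewrite -intr_norm -[ltRHS]/(1%:~R) ltr_int.
  by lia.
- move=> x xin; have := hu (xrow x); rewrite mem_cat (map_f xrow) // orbT => /(_ isT).
  have -> : \sum_i ((u i)%:R - (u' i)%:R) * xrow x 0 i = dot (raw_dir w) x.
    by rewrite dot_raw_dir; apply: eq_bigr => i _; rewrite mxE wR.
  rewrite dotZl normrM => /ltW hx; apply: le_trans hx.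
  rewrite -[leRHS]mul1r ler_wpM2r // ger0_norm ?invr_ge0 ?sqrtr_ge0 //.
  rewrite invf_le1 ?sqrtr_gt0 // -sqrtr1 ler_sqrt //; exact: ltW.
Qed.

End Directions.

(** * Choice of parameters, counting and conclusion *)

Lemma block_exists h D P : (0 < h)%N -> (P * D <= h)%N ->
  exists blk : nat -> 'I_D -> 'I_h, forall p p' i i', (p < P)%N -> (p' < P)%N ->
    blk p i = blk p' i' -> p = p' /\ i = i'.
Proof.
move=> h0 hPD; exists (fun p i => insubd (Ordinal h0) (p * D + i)%N).
have lt p (i : 'I_D) : (p < P)%N -> (p * D + i < h)%N.
  move=> pP; apply: leq_trans hPD; apply: (@leq_trans (p.+1 * D)).
    by rewrite mulSn addnC ltn_add2r.
  by rewrite leq_mul2r pP orbT.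
move=> p p' i i' pP pP' /(congr1 val); rewrite !val_insubd !lt // => e.
have D0 : (0 < D)%N := leq_ltn_trans (leq0n _) (ltn_ord i).
have := congr1 (divn^~ D) e; have := congr1 (modn^~ D) e => /=.
rewrite !modnMDl !modn_small // => ei.
by rewrite !divnMDl // !divn_small // !addn0 => ->; split=> //; apply: val_inj.
Qed.

Lemma adversary (R : realType) (d h n k P q s M : nat) (A : mem_algo R d M)
    (eps := 1 / (48 * (d%:R) ^+ 2 * Num.sqrt (d%:R)) : R) :
  d = (h + n)%N ->
  (0 < n)%N -> (0 < k)%N -> (0 < P)%N -> (P * (12 * k) <= h)%N ->
  (q ^ 2 <= d)%N -> (400 <= d)%N ->
  solves_feasibility A eps ->
  (P * 2 ^ M * (P * (2 * d).+1 ^ (12 * k)) ^ (P * k) * 2 ^ n *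
     (3 ^ (12 * k)) ^ n * (q ^ k) ^ s < (q ^ k) ^ n)%N ->
  exists Q O, feasibility_instance eps Q O /\
    forall t, (t < P * s)%N -> O (query_at A O t) <> None.
Proof.
move=> dE; subst d; move=> n0 k0 P0 hPD hq d400 solves big.
set d := (h + n)%N in eps hq d400 solves big *.
have d0 : (0 < d)%N by apply: leq_trans d400.
have Pk12 : (12 * (P * k) <= h)%N by rewrite mulnCA.
have k12 : (12 * k <= h)%N by apply: leq_trans hPD; rewrite leq_pmull.
have hd : (h <= d)%N by rewrite leq_addr.
have nd : (n <= d)%N by rewrite leq_addl.
have h0 : (0 < h)%N by apply: leq_trans k12; rewrite muln_gt0.
have [blk blk_inj] := block_exists h0 hPD.
have dR0 : 0 < d%:R :> R by rewrite ltr0n.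
pose r : R := (Num.sqrt d%:R)^-1.
have sd0 : 0 < Num.sqrt d%:R :> R by rewrite sqrtr_gt0.
have r0 : 0 < r by rewrite invr_gt0.
have r2 : r ^+ 2 = d%:R^-1 by rewrite exprVn sqr_sqrtr // ltW.
have r2d : r ^+ 2 * d%:R = 1 by rewrite r2 mulVf // gt_eqF.
have r20 : r <= 20^-1.
  rewrite lef_pV2 ?posrE // -(ler_sqr (ler0n _ 20) (ltW sd0)) sqr_sqrtr ?(ltW dR0) //.
  by rewrite -natrX ler_nat.
have r1 : r <= 1 by apply: (le_trans r20); lra.
have epsE : eps = r ^+ 5 / 48.
  by rewrite /eps /r -{1}(sqr_sqrtr (ltW dR0)); field; rewrite gt_eqF.
(* These choices give [eta = mu * eps] and [16 * tau ^+ 2 * d = 1]. The step [theta], of order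
   [1 / d], keeps translations bounded for [q ^ 2 <= d] and [k <= d], and [theta * tau = 4 * eta] is
   twice the slab term in [gap]. *)
pose lam : R := d%:R; pose mu : R := 2 * d%:R; pose eta : R := r ^+ 3 / 24.
pose tau : R := r / 4; pose theta : R := 2 * r ^+ 2 / 3; pose rho : R := r ^+ 6.
have rE i : 0 <= r ^+ i by rewrite exprn_ge0 // ltW.
(* Each further power of [r] gains a factor 20, so that linear arithmetic can compare powers. *)
have rS i : r ^+ i.+1 <= r ^+ i / 20.
  by rewrite exprSr ler_wpM2l.
have r6d : r ^+ 6 * d%:R ^+ 3 = 1 by rewrite (exprM r 2 3) -exprMn r2d expr1n.
pose B := (d ^ 4)%N.
have r8B : r ^+ 8 * B%:R = 1 by rewrite /B natrX (exprM r 2 4) -exprMn r2d expr1n.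
have B0 : (0 < B)%N by rewrite expn_gt0 d0.
have BV : B%:R^-1 = r ^+ 8.
  by apply: (mulIf (x := B%:R)); rewrite ?r8B ?mulVf // pnatr_eq0 -lt0n.
have eps0 : 0 <= eps by rewrite epsE mulr_ge0.
have inst (w0 : dir (12 * k) d P) (S : grid h n B) L :
    orthonormal_dirs w0 (@unit_dir R h (12 * k) d P blk) L -> (size L <= P * k)%N ->
    feasibility_instance eps
      (halfspace_body (constraints (unit_dir R blk) lam eta tau S L))
      (game_oracle (unit_dir R blk) lam eta tau S L).
  move=> oL sL; apply: (game_instance (mu := mu) B0 _ _ _ _ _ eps0 _ _ _ oL).
  - by rewrite /lam.
  - by rewrite /lam -natrM -natrX ler_nat expnS expn1 leq_mul.
  - by rewrite /mu mulr_ge0.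
  - rewrite /lam /mu exprMn.
    have : h%:R <= d%:R ^+ 2 :> R.
      by rewrite -natrX ler_nat (leq_trans hd) // expnS expn1 leq_pmulr.
    have : 0 <= d%:R ^+ 2 :> R by rewrite sqr_ge0.
    lra.
  - rewrite /mu epsE /eta.
    have -> : 2 * d%:R * (r ^+ 5 / 48) = (r ^+ 2 * d%:R) * (r ^+ 3 / 24).
      by rewrite (exprD r 2 3); field.
    by rewrite r2d mul1r.
  - rewrite epsE /tau; have := rS 4; have := rS 3; have := rS 2; have := rS 1.
    by rewrite expr1; have := rE 4; have := rE 3; have := rE 2; lra.
  - rewrite epsE exprMn -exprM.
    have : r ^+ 10 <= 1 by rewrite exprn_ile1 // ltW.
    by have := rE 10; lra.
  - rewrite /tau exprMn.
    have : r ^+ 2 * (size L)%:R <= 1.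
      rewrite -[leRHS]r2d ler_wpM2l // ler_nat (leq_trans sL) // (leq_trans _ hd) //.
      by apply: leq_trans Pk12; rewrite leq_pmull.
    lra.
pose w0 : dir (12 * k) d P := (Ordinal P0, [ffun=> ord0]).
(* With [12 * k] unknowns and [2 * k] forms, the number of cells only has to stay below
   [(d + 1) ^ 6]. Its factor [d ^ 3] is [1 / rho]. *)
have N_lt : ((2 * (12 * k) * d * d ^ 3).+1 ^ (2 * k) < d.+1 ^ (12 * k))%N.
  rewrite (_ : d.+1 ^ (12 * k) = (d.+1 ^ 6) ^ (2 * k))%N; last first.
    by rewrite -expnM; congr (_ ^ _)%N; lia.
  have k20 : (0 < 2 * k)%N by rewrite muln_gt0.
  rewrite ltn_exp2r //; apply: (@leq_ltn_trans (d ^ 6)); last by rewrite ltn_exp2r.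
  apply: (@leq_ltn_trans (2 * d ^ 5)).
    rewrite (_ : 2 * d ^ 5 = 2 * d * d * d ^ 3)%N; last by rewrite !expnS; lia.
    by rewrite !leq_mul2r leq_mul2l (leq_trans k12) ?orbT.
  rewrite (expnS d 5) ltn_pmul2r ?expn_gt0 ?d0 //.
  exact: leq_trans d400.
have N_rho : 2 * (12 * k)%:R * d%:R < (2 * (12 * k) * d * d ^ 3).+1%:R * rho.
  rewrite -[X in _ < X * _]natr1 !natrM.
  set t := 2 * (12 * k%:R) * d%:R.
  have -> : (t * (d%:R * (d%:R * d%:R)) + 1) * rho = t * (r ^+ 6 * d%:R ^+ 3) + rho.
    by rewrite /rho; ring.
  by rewrite r6d mulr1 ltrDl exprn_gt0.
have rho_d : rho * d%:R <= 1.
  by rewrite /rho -[leRHS]r6d ler_wpM2l ?rE // -natrX ler_nat (expnS d 2) leq_pmulr // expn_gt0 d0.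
have rho_tau : rho < tau.
  rewrite /rho /tau; have := rS 5; have := rS 4; have := rS 3; have := rS 2.
  have := rS 1; have := rE 5; have := rE 4; have := rE 3; have := rE 2.
  rewrite expr1; lra.
have kd : k%:R <= d%:R :> R by rewrite ler_nat (leq_trans _ hd) // (leq_trans _ k12) // leq_pmull.
have q2d : q%:R ^+ 2 <= d%:R :> R by rewrite -natrX ler_nat.
have qd : q%:R <= d%:R :> R.
  rewrite ler_nat; apply: leq_trans hq; rewrite expnS expn1.
  by case: (q) => // q'; rewrite leq_pmulr.
have r4d : r ^+ 4 * (d%:R * d%:R) = 1 by rewrite (exprM r 2 2) -expr2 -exprMn r2d expr1n.
have theta0 : 0 <= theta by rewrite /theta mulr_ge0 // mulr_ge0.
have gap : 2 * eta + k%:R * (q%:R * theta * rho) + h%:R / B%:R < theta * tau.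
  have -> : theta * tau = r ^+ 3 / 6 by rewrite /theta /tau (exprSr r 2); field.
  have t2 : k%:R * (q%:R * theta * rho) <= 2 / 3 * r ^+ 4.
    have -> : k%:R * (q%:R * theta * rho) = 2 / 3 * r ^+ 4 * (r ^+ 4 * (k%:R * q%:R)).
      by rewrite /theta /rho; ring.
    have c0 : 0 <= 2 / 3 * r ^+ 4 by have := rE 4; lra.
    by rewrite -[leRHS]mulr1 -[X in _ <= _ * X]r4d ler_wpM2l // ler_wpM2l ?rE // ler_pM.
  have t3 : h%:R / B%:R <= r ^+ 6.
    rewrite BV (exprD r 6 2) mulrCA -[leRHS]mulr1 ler_wpM2l ?rE // mulrC.
    by rewrite -[leRHS]r2d ler_wpM2l ?rE // ler_nat.
  have := rS 5; have := rS 4; have := rS 3; have := rE 4; have := rE 5.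
  have : 0 < r ^+ 3 by rewrite exprn_gt0.
  by rewrite /eta; lra.
have sb : theta ^+ 2 * q%:R ^+ 2 * k%:R <= 1.
  have -> : theta ^+ 2 * q%:R ^+ 2 * k%:R = 4 / 9 * (r ^+ 4 * (q%:R ^+ 2 * k%:R)).
    by rewrite /theta; field.
  have : r ^+ 4 * (q%:R ^+ 2 * k%:R) <= 1 by rewrite -[leRHS]r4d ler_wpM2l ?rE // ler_pM // sqr_ge0.
  lra.
have big' : (P * 2 ^ M * #|{: dir (12 * k) d P}| ^ (P * k) * 2 ^ n *
    (3 ^ (12 * k)) ^ n * (q ^ k) ^ s < (q ^ k) ^ n)%N by rewrite card_dir.
have rho0 : 0 < rho by rewrite exprn_gt0.
have [S [L [oL sL hL]]] := long_run (w0 := w0) k0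
  (fun S L oL sL => solves _ _ (inst w0 S L oL sL))
  (unit_dir_ex blk_inj rho0 d0 rho_d N_lt N_rho) (@unit_dir_disj R _ _ _ _ _ blk_inj)
  rho_tau (Ordinal n0) B0 theta0 (ltW rho0) gap sb
  (@unit_dir_supp R h (12 * k) d P blk) big'.
exists (halfspace_body (constraints (unit_dir R blk) lam eta tau S L)).
exists (game_oracle (unit_dir R blk) lam eta tau S L); split=> //.
by apply: (inst w0); rewrite ?sL.
Qed.

(** The combinations of the revealed rows take half of the exponent [16 * k * m] of [q]. The
    remaining factors form four groups, each at most [q ^ (k * m)]. *)
Lemma count_bound d m K k P q e M :
  (2 ^ e <= q)%N -> (400 <= e)%N -> (d < q.+1 ^ 2)%N -> (m <= d)%N ->
  (P * k <= K)%N -> (39 * K <= m)%N -> (3 <= m)%N -> (0 < k)%N ->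
  (M <= e * (k * m))%N ->
  (P * 2 ^ M * (P * (2 * d).+1 ^ (12 * k)) ^ (P * k) * 2 ^ (16 * m) *
     (3 ^ (12 * k)) ^ (16 * m) * (q ^ k) ^ (8 * m) < (q ^ k) ^ (16 * m))%N.
Proof.
move=> eq e400 dq md PK Km m3 k0 Me.
have q8 : (8 <= q)%N.
  by apply: leq_trans eq; rewrite (@leq_pexp2l 2 3) // (leq_trans _ e400).
have q1 : (1 < q)%N by apply: leq_trans q8.
have qle a b : (a <= b)%N -> (q ^ a <= q ^ b)%N by rewrite leq_exp2l.
have dq3 : ((2 * d).+1 <= q ^ 3)%N.
  have : (2 * q.+1 ^ 2 <= q ^ 3)%N by rewrite !expnS expn0; nia.
  by move: dq; lia.
have km3 : (3 <= k * m)%N by rewrite (leq_trans m3) // leq_pmull.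
have PPk : (P <= P * k)%N by rewrite leq_pmulr.
have Pq : (P <= q ^ 3)%N.
  by apply: leq_trans dq3; move: (leq_trans PPk PK) Km md; lia.
have pow2 a : (2 ^ (e * a) <= q ^ a)%N.
  by rewrite expnM; case: a => [|a]; rewrite ?expn0 // leq_exp2r.
have f1 : (P <= q ^ (k * m))%N := leq_trans Pq (qle _ _ km3).
have f2 : (2 ^ M <= q ^ (k * m))%N.
  by apply: leq_trans (pow2 _); rewrite leq_exp2l.
(* A direction costs [q ^ (39 * k)]: the period and [12 * k] coordinates, each at most [q ^ 3]. *)
have f3 : ((P * (2 * d).+1 ^ (12 * k)) ^ (P * k) <= q ^ (k * m))%N.
  apply: (@leq_trans ((q ^ (39 * k)) ^ (P * k))).
    case: (P * k)%N => [|pk]; first by rewrite !expn0.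
    rewrite leq_exp2r //; apply: (@leq_trans (q ^ 3 * q ^ (36 * k))).
      rewrite leq_mul // (_ : 36 * k = 3 * (12 * k))%N; last by lia.
      by rewrite [leqRHS]expnM leq_exp2r // muln_gt0.
    by rewrite -expnD qle //; lia.
  rewrite -expnM qle // (_ : 39 * k * (P * k) = k * (39 * (P * k)))%N; last by lia.
  by rewrite leq_mul2l (leq_trans _ Km) ?orbT // leq_mul2l PK.
(* With 3 replaced by 4 the exponents of 2 add up to [16 + 384 = 400] times [k * m], and
   [q >= 2 ^ 400]. *)
have f4 : (2 ^ (16 * m) * (3 ^ (12 * k)) ^ (16 * m) <= q ^ (k * m))%N.
  apply: (@leq_trans (2 ^ (16 * (k * m)) * 2 ^ (384 * (k * m)))); last first.
    rewrite -expnD -mulnDl; apply: leq_trans (pow2 _).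
    by rewrite leq_exp2l // leq_mul2r e400 orbT.
  apply: leq_mul; first by rewrite leq_exp2l // leq_mul2l leq_pmull.
  apply: (@leq_trans ((4 ^ (12 * k)) ^ (16 * m))).
    by rewrite !leq_exp2r // muln_gt0 ?(leq_trans _ m3).
  rewrite (_ : 4 = 2 ^ 2)%N // -!expnM leq_exp2l //; lia.
apply: (@leq_ltn_trans (q ^ (k * m) * q ^ (k * m) * q ^ (k * m) * q ^ (k * m) *
    (q ^ k) ^ (8 * m))).
  rewrite leq_mul2r -[X in (X <= _)%N]mulnA; apply/orP; right.
  by apply: leq_mul f4; apply: leq_mul f3; apply: leq_mul f1 f2.
rewrite -!expnM -!expnD ltn_exp2l //; lia.
Qed.

Lemma sqrt_floor d : exists q, (q ^ 2 <= d < q.+1 ^ 2)%N.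
Proof.
elim: d => [|d [q /andP[h1 h2]]]; first by exists 0%N.
have [h3|h3] := ltnP d.+1 (q.+1 ^ 2); first by exists q; rewrite h3 ltnW.
by exists q.+1; rewrite h3 (leq_ltn_trans h2) // ltn_exp2r.
Qed.

(** Rounding down costs at most a factor 2 in each division, whence the constants 64 and 78. *)
Lemma size_choice : exists G d1 : nat, (0 < G)%N /\ forall d, (d1 <= d)%N ->
  [/\ (d ^ 2 <= G * (d %/ 32 %/ 39 * (d %/ 32)))%N, (3 <= d %/ 32)%N,
      (2 <= d %/ 32 %/ 39)%N & (1 <= d)%N].
Proof.
exists (64 * (64 * 78))%N, (32 * (39 * 2))%N; split=> // d hd.
have m2 : (39 * 2 <= d %/ 32)%N by rewrite leq_divRL // mulnC.
have K2 : (2 <= d %/ 32 %/ 39)%N by rewrite leq_divRL // mulnC.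
have := ltn_ceil d (isT : 0 < 32)%N; have := ltn_ceil (d %/ 32) (isT : 0 < 39)%N.
move: (d %/ 32)%N m2 K2 => m m2; move: (m %/ 39)%N => K K2 h1 h2.
have mK : (m <= 78 * K)%N by lia.
have dm : (d <= 64 * m)%N by lia.
split=> //; [|by lia|by lia].
apply: (@leq_trans (64 * m * (64 * (78 * K)))%N); last by lia.
rewrite expnS expn1 leq_mul // (leq_trans dm) // leq_mul2l mK orbT //.
Qed.

Lemma leq_double_trunc K k : (0 < k <= K)%N -> (K <= 2 * (K %/ k * k))%N.
Proof.
move=> /andP[k0 kK]; have := ltn_ceil K k0.
have : (k <= K %/ k * k)%N by rewrite leq_pmull // divn_gt0.
by rewrite mulSn; lia.
Qed.

(** The [16 * m] rows take at most half of the coordinates, which leaves room for the blocks. *)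
Lemma size_split d m K P k : (32 * m <= d)%N -> (39 * K <= m)%N -> (P * k <= K)%N ->
  exists h, d = (h + 16 * m)%N /\ (P * (12 * k) <= h)%N.
Proof.
by move=> md Km PK; exists (d - 16 * m)%N; split; first lia; rewrite mulnCA; lia.
Qed.

Theorem theorem2 (R : realType) :
  exists (c : R) (k : nat) (d0 : nat), 0 < c /\
  forall (d : nat), (d0 <= d)%N ->
  forall (delta : R), 0 <= delta -> delta <= 1 ->
  forall (M : nat) (A : mem_algo R d M),
    solves_feasibility A (1 / (48 * (d%:R) ^+ 2 * Num.sqrt (d%:R))) ->
    (d%:R `^ (2 - delta) <= M%:R) \/
    exists Q O, feasibility_instance (1 / (48 * (d%:R) ^+ 2 * Num.sqrt (d%:R))) Q O /\
      makes_at_least A O (c * d%:R `^ (1 + delta) / (ln (d%:R)) ^+ k).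
Proof.
have [G [d1 [G0 hd1]]] := size_choice.
(* [count_bound] asks for 400; [2 * G] serves to fit the memory into [e * (k * m)] bits. *)
have [e [e400 eG]] : exists e, (400 <= e)%N /\ (2 * G <= e)%N.
  by exists (2 * G + 400)%N; rewrite leq_addl leq_addr.
(* The logarithm gets exponent 0; [d] is large enough for [2 ^ e] to be at most the integer square
   root of [d]. *)
exists (2 / G%:R), 0%N, (d1 + (2 ^ e) ^ 2 + 400)%N.
have GR : 0 < G%:R :> R by rewrite ltr0n.
split=> [|d hd delta dl0 dl1 M A solves]; first by rewrite divr_gt0.
have [dd m3 K2 d0] : [/\ (d ^ 2 <= G * (d %/ 32 %/ 39 * (d %/ 32)))%N,
    (3 <= d %/ 32)%N, (2 <= d %/ 32 %/ 39)%N & (1 <= d)%N].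
  by apply: hd1; apply: leq_trans hd; rewrite -addnA leq_addr.
have [q /andP[q2d dq]] := sqrt_floor d.
have eq : (2 ^ e <= q)%N.
  rewrite -ltnS -(@ltn_exp2r _ _ 2) //; apply: leq_ltn_trans dq.
  by apply: leq_trans hd; rewrite addnAC leq_addl.
have d400 : (400 <= d)%N by apply: leq_trans hd; rewrite leq_addl.
clear hd hd1.
set m := (d %/ 32)%N in dd m3 K2; set K := (m %/ 39)%N in dd K2.
have md : (32 * m <= d)%N by rewrite mulnC leq_trunc_div.
have Km : (39 * K <= m)%N by rewrite mulnC leq_trunc_div.
have [hM|hM] := leP (d%:R `^ (2 - delta)) (M%:R : R); [by left|right].
have dR0 : 0 < d%:R :> R by rewrite ltr0n.
have dRn0 : d%:R != 0 :> R by rewrite gt_eqF.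
have dR1 : 1 <= d%:R :> R by rewrite ler1n.
pose x : R := d%:R `^ (1 - delta).
have x1 : 1 <= x by rewrite /x -[leLHS](powRr0 d%:R) ler_powR // subr_ge0.
have xd : x <= d%:R.
  by rewrite /x -[leRHS](powRr1 (ltW dR0)) ler_powR // lerBlDr lerDl.
have d2x : d%:R `^ (2 - delta) = d%:R * x.
  rewrite /x (_ : 2 - delta = 1 + (1 - delta)); last by ring.
  by rewrite powRD ?(powRr1 (ltW dR0)) // dRn0 implybT.
have x0 : 0 < x := lt_le_trans ltr01 x1.
have d1x : d%:R `^ (1 + delta) = d%:R ^+ 2 / x.
  rewrite /x (_ : 1 + delta = 2 - (1 - delta)); last by ring.
  by rewrite powRB ?(powR_mulrn 2 (ltW dR0)) // dRn0 implybT.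
have KR2 : 2 <= K%:R :> R by rewrite ler_nat.
have mled : (m <= d)%N by rewrite leq_div.
have Kd : K%:R <= d%:R :> R by rewrite ler_nat (leq_trans _ mled) // leq_div.
have ddR : d%:R ^+ 2 <= G%:R * (K%:R * m%:R) :> R.
  by rewrite -natrX -!natrM ler_nat.
(* [y] has the order of [x]; the factor [K / (2 * d)] keeps [k], one more than its integer part,
   between 1 and [K]. *)
pose y : R := x * K%:R / (2 * d%:R).
have y0 : 0 <= y by rewrite divr_ge0 ?mulr_ge0 // ltW.
have yE : y * (2 * d%:R) = x * K%:R by rewrite /y divfK // mulf_neq0.
pose k := (Num.truncn y).+1.
have /andP[ky1 ky2] := truncn_itv y0.
have {}ky1 : k%:R <= y + 1 by rewrite /k -natr1 lerD2r.
have yK : y <= K%:R / 2.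
  rewrite /y ler_pdivrMr ?mulr_gt0 // [leRHS](_ : _ = d%:R * K%:R); last by field.
  by rewrite ler_wpM2r.
have yx : y <= x / 2.
  rewrite /y ler_pdivrMr ?mulr_gt0 // [leRHS](_ : _ = x * d%:R); last by field.
  by rewrite ler_wpM2l // ltW.
have k0 : (0 < k)%N by [].
have kK : (k <= K)%N by rewrite -(ler_nat R); lra.
have kx : k%:R <= 2 * x by lra.
pose P := (K %/ k)%N.
have P0 : (0 < P)%N by rewrite divn_gt0.
have PK : (P * k <= K)%N by rewrite leq_trunc_div.
have KP : (K <= 2 * (P * k))%N by rewrite leq_double_trunc ?k0.
(* From [M < d * x], [d ^ 2 <= G * K * m] and [x * K = 2 * d * y <= 2 * d * k]. *)
have Me : (M <= e * (k * m))%N.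
  apply: (@leq_trans (2 * G * (k * m))); last by rewrite leq_mul2r eG orbT.
  rewrite -(ler_nat R) !natrM; apply: ltW; apply: lt_le_trans hM _.
  rewrite d2x -(ler_pM2l dR0).
  have h1 : d%:R * (d%:R * x) <= G%:R * (K%:R * m%:R) * x.
    by rewrite mulrA -expr2 ler_wpM2r // ltW.
  apply: (le_trans h1).
  have -> : G%:R * (K%:R * m%:R) * x = G%:R * m%:R * (y * (2 * d%:R)).
    by rewrite yE; ring.
  have -> : d%:R * (2 * G%:R * (k%:R * m%:R)) = G%:R * m%:R * (k%:R * (2 * d%:R)) :> R by ring.
  by rewrite ler_wpM2l ?mulr_ge0 // ler_wpM2r ?mulr_ge0 // ltW.
have big := count_bound eq e400 dq mled PK Km m3 k0 Me.
have [h [dE hPk]] := size_split md Km PK.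
pose n := (16 * m)%N; rewrite -/n in dE big.
have n0 : (0 < n)%N by rewrite muln_gt0 (leq_trans _ m3).
(* There are [P] periods of [8 * m] queries; [K <= 2 * P * k] and [k <= 2 * x] give
   [K <= 4 * P * x]. *)
have T : P%:R * (8 * m%:R) >= 2 / G%:R * d%:R `^ (1 + delta) :> R.
  rewrite d1x mulrA ler_pdivrMr // mulrAC ler_pdivrMr //.
  have h1 : 2 * d%:R ^+ 2 <= 2 * (G%:R * (K%:R * m%:R)) :> R by rewrite ler_wpM2l.
  apply: (le_trans h1).
  have h2 : K%:R <= P%:R * (4 * x).
    apply: (@le_trans _ _ (P%:R * (2 * k%:R))).
      by rewrite -!natrM ler_nat mulnCA.
    by rewrite ler_wpM2l //; lra.
  have -> : P%:R * (8 * m%:R) * x * G%:R = 2 * (G%:R * (P%:R * (4 * x) * m%:R)) by ring.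
  apply: ler_wpM2l => //; apply: ler_wpM2l; first exact: ltW.
  exact: ler_wpM2r.
have [Q [orc [inst horc]]] := adversary dE n0 k0 P0 hPk q2d d400 solves big.
exists Q, orc; split=> // t; rewrite expr0 divr1 => ht; apply: horc.
by rewrite -(ltr_nat R) !natrM; lra.
Qed.
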